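(* Let $\mathbb{k}$ be an infinite field, $R$ a Cohen-Macaulay finitely generated $\mathbb{k}$-algebra of dimension $d$, and $I\subset R$ an ideal of positive height. Assume that $I$ satisfies $G_d$ and is weakly $(d-2)$-residually $S_2$. Then $\operatorname{core}(I_{\mathfrak p})=(\operatorname{core}(I))_{\mathfrak p}$ for every $\mathfrak p\in\operatorname{Spec}(R)$.
   Context: A subideal $J\subseteq I$ is a reduction of $I$ if $I^{m+1}=JI^m$ for $m\gg0$. The core of an ideal is the intersection of all of its reductions; $\operatorname{core}(I_{\mathfrak p})$ is computed in the ring $R_{\mathfrak p}$. $G_s$: $I$ satisfies $G_s$ if $\mu(I_{\mathfrak p})\leqslant \operatorname{ht}(\mathfrak p)$ for every $\mathfrak p\in V(I)$ with $\operatorname{ht}(\mathfrak p)\leqslant s-1$, where $\mu$ is the minimal number of generators. Residual intersections: an ideal $K$ is an $s$-residual intersection of $I$ if $K=\mathfrak a:I$ for some ideal $\mathfrak a\subsetneq I$ generated by $s$ elements with $\operatorname{ht}(K)\geqslant s$; it is geometric if in addition $\operatorname{ht}(I+K)>s$ (the unit ideal has infinite height). $I$ is weakly $s$-residually $S_2$ if $R/K$ satisfies Serre's condition $S_2$ for every $0\leqslant i\leqslant s$ and every geometric $i$-residual intersection $K$ of $I$. *)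

(* Defs.v *)
From HB Require Import structures.
From mathcomp Require Import all_boot all_order all_algebra.
From mathcomp Require Import generic_quotient ring_quotient.
From mathcomp Require Import boolp classical_sets cardinality constructive_ereal.
From mathcomp Require Import ring.

Set Implicit Arguments.
Unset Strict Implicit.
Unset Printing Implicit Defensive.

Import Order.TTheory GRing.Theory Num.Theory.

Local Open Scope classical_set_scope.
Local Open Scope ring_scope.
Local Open Scope quotient_scope.

(* Ideals; unlike [idealr], the unit ideal is allowed and membership is a
   proposition.  Rings are [comPzRingType]s so that quotients by the unit ideal
   are rings as well. *)
Record ideal (R : comPzRingType) := Ideal {
  ideal_set :> R -> Prop;
  ideal_zero : ideal_set 0;
  ideal_add : forall x y, ideal_set x -> ideal_set y -> ideal_set (x + y);
  ideal_mul : forall a x, ideal_set x -> ideal_set (a * x) }.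

Record Spec (R : comPzRingType) := PrimeIdeal {
  spec_ideal :> ideal R;
  spec_proper : ~ spec_ideal 1;
  spec_prime : forall x y,
    spec_ideal (x * y) -> spec_ideal x \/ spec_ideal y }.

Section IdealOperations.
Variable R : comPzRingType.
Implicit Types (A : set R) (I J : ideal R).

Definition ideal_gen A : ideal R.
Proof.
exists [set x | forall J : ideal R, A `<=` J -> J x].
- by move=> J _; exact: ideal_zero.
- by move=> x y Hx Hy J AJ; apply: ideal_add; [exact: Hx|exact: Hy].
- by move=> a x Hx J AJ; apply: ideal_mul; exact: Hx.
Defined.

Definition ideal_sum I J : ideal R := ideal_gen (I `|` J).

Definition ideal_prod I J : ideal R :=
  ideal_gen [set x * y | x in I & y in J].

Definition ideal_exp I (n : nat) : ideal R :=
  iter n (ideal_prod I) (ideal_gen setT).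

Definition colon J I : ideal R.
Proof.
exists [set x | forall y, I y -> J (x * y)].
- by move=> y _; rewrite mul0r; exact: ideal_zero.
- by move=> x z Hx Hz y Iy; rewrite mulrDl; apply: ideal_add; auto.
- by move=> a x Hx y Iy; rewrite -mulrA; apply: ideal_mul; auto.
Defined.

Definition reduction J I : Prop :=
  J `<=` I /\
  exists m0 : nat, forall m : nat, (m0 <= m)%N ->
    ideal_exp I m.+1 = ideal_prod J (ideal_exp I m) :> set R.

Definition core I : ideal R.
Proof.
exists [set x | forall J, reduction J I -> J x].
- by move=> J _; exact: ideal_zero.
- by move=> x y Hx Hy J rJ; apply: ideal_add; auto.
- by move=> a x Hx J rJ; apply: ideal_mul; auto.
Defined.

End IdealOperations.

Section Quotient.
Variables (R : comPzRingType) (K : ideal R).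

Definition ideal_pred : {pred R} := fun x => `[< K x >].

Fact ideal_pred_closed : zmod_closed ideal_pred.
Proof.
split; first by apply/asboolP; exact: ideal_zero.
move=> x y /asboolP Kx /asboolP Ky; apply/asboolP.
by rewrite -[y]mul1r -mulNr; apply: ideal_add => //; exact: ideal_mul.
Qed.
HB.instance Definition _ := GRing.isZmodClosed.Build R ideal_pred
  ideal_pred_closed.

Definition quotient : Type := Quotient.quot ideal_pred.
HB.instance Definition _ := GRing.Zmodule.on quotient.

Definition quotient_map (x : R) : quotient :=
  \pi_(Quotient.quot ideal_pred) x.

Lemma quotient_mapP x y : quotient_map x = quotient_map y <-> K (x - y).
Proof.
rewrite /quotient_map; split; last by move=> h; apply/eqmodP/asboolP.
by move/eqmodP/asboolP.
Qed.

Definition quotient_repr (a : quotient) : R :=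
  repr (a : Quotient.quot ideal_pred).

Lemma quotient_reprK a : quotient_map (quotient_repr a) = a.
Proof. exact: reprK. Qed.

Lemma quotient_mapD x y :
  quotient_map (x + y) = quotient_map x + quotient_map y.
Proof. exact: (raddfD (\pi_(Quotient.quot ideal_pred) : {additive R -> _})). Qed.

Definition quotient_mul (a b : quotient) : quotient :=
  quotient_map (quotient_repr a * quotient_repr b).

Lemma quotient_mapM x y :
  quotient_map (x * y) = quotient_mul (quotient_map x) (quotient_map y).
Proof.
apply/quotient_mapP.
have /quotient_mapP hx := quotient_reprK (quotient_map x).
have /quotient_mapP hy := quotient_reprK (quotient_map y).
set x' := quotient_repr _ in hx *; set y' := quotient_repr _ in hy *.
have -> : x * y - x' * y' = (- y) * (x' - x) + (- x') * (y' - y) by ring.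
by apply: ideal_add; exact: ideal_mul.
Qed.

Lemma quotient_ind (P : quotient -> Prop) :
  (forall x, P (quotient_map x)) -> forall a, P a.
Proof. by move=> h a; rewrite -(quotient_reprK a). Qed.

Fact quotient_mulA : associative quotient_mul.
Proof.
elim/quotient_ind=> x; elim/quotient_ind=> y; elim/quotient_ind=> z.
by rewrite -!quotient_mapM mulrA.
Qed.

Fact quotient_mulC : commutative quotient_mul.
Proof.
elim/quotient_ind=> x; elim/quotient_ind=> y.
by rewrite -!quotient_mapM mulrC.
Qed.

Fact quotient_mul1 : left_id (quotient_map 1) quotient_mul.
Proof. by elim/quotient_ind=> x; rewrite -quotient_mapM mul1r. Qed.

Fact quotient_mulDl : left_distributive quotient_mul +%R.
Proof.
elim/quotient_ind=> x; elim/quotient_ind=> y; elim/quotient_ind=> z.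
by rewrite -!(quotient_mapM, quotient_mapD) mulrDl.
Qed.

HB.instance Definition _ := GRing.Zmodule_isComPzRing.Build quotient
  quotient_mulA quotient_mulC quotient_mul1 quotient_mulDl.

Fact quotient_map_zmod_morphism : zmod_morphism quotient_map.
Proof.
move=> x y; have := quotient_mapD (x - y) y; rewrite subrK => ->.
by rewrite addrK.
Qed.
HB.instance Definition _ := GRing.isZmodMorphism.Build R quotient quotient_map
  quotient_map_zmod_morphism.

Fact quotient_map_monoid_morphism : monoid_morphism quotient_map.
Proof. by split=> // x y; exact: quotient_mapM. Qed.
HB.instance Definition _ := GRing.isMonoidMorphism.Build R quotient
  quotient_map quotient_map_monoid_morphism.

End Quotient.

Section Localization.
Variables (R : comPzRingType) (p : Spec R).

Definition denominator : Type := {s : R | `[< ~ p s >]}.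
HB.instance Definition _ := Choice.on denominator.

Fact denominatorP (s : denominator) : ~ p (val s).
Proof. by apply/asboolP; exact: (valP s). Qed.

Definition denominator1 : denominator.
Proof. by exists 1; apply/asboolP; exact: spec_proper. Defined.

Definition denominatorM (s t : denominator) : denominator.
Proof.
exists (val s * val t); apply/asboolP.
by case/spec_prime; exact: denominatorP.
Defined.

Definition fraction : Type := (R * denominator)%type.
HB.instance Definition _ := Choice.on fraction.

Definition fraction_eq (x y : fraction) : bool :=
  `[< exists u : denominator,
        val u * (x.1 * val y.2) = val u * (y.1 * val x.2) >].

Fact fraction_eq_refl : reflexive fraction_eq.
Proof. by move=> x; apply/asboolP; exists denominator1. Qed.

Fact fraction_eq_sym : symmetric fraction_eq.
Proof.
by move=> x y; apply/asboolP/asboolP => -[u h]; exists u; rewrite h.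
Qed.

Fact fraction_eq_trans : transitive fraction_eq.
Proof.
move=> [b t] [a s] [c r] /asboolP[u /= hu] /asboolP[v /= hv].
apply/asboolP; exists (denominatorM (denominatorM u v) t) => /=.
have -> : val u * val v * val t * (a * val r) =
  val v * val r * (val u * (a * val t)) by ring.
rewrite hu.
have -> : val v * val r * (val u * (b * val s)) =
  val u * val s * (val v * (b * val r)) by ring.
by rewrite hv /=; ring.
Qed.

Canonical fraction_equiv :=
  EquivRel fraction_eq fraction_eq_refl fraction_eq_sym fraction_eq_trans.

Definition localization : Type := {eq_quot fraction_eq}.
HB.instance Definition _ := Choice.on localization.

Definition frac (a : R) (s : denominator) : localization :=
  \pi_{eq_quot fraction_eq} ((a, s) : fraction).

Lemma fracP a s b t :
  frac a s = frac b t <->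
  exists u : denominator, val u * (a * val t) = val u * (b * val s).
Proof.
rewrite /frac; split; first by move/eqmodP/asboolP.
by move=> h; apply/eqmodP/asboolP.
Qed.

Definition num (x : localization) : R := (repr (x : {eq_quot fraction_eq})).1.
Definition den (x : localization) : denominator :=
  (repr (x : {eq_quot fraction_eq})).2.

Lemma num_den x : frac (num x) (den x) = x.
Proof. by rewrite /frac /num /den -surjective_pairing; exact: reprK. Qed.

Lemma localization_ind (P : localization -> Prop) :
  (forall a s, P (frac a s)) -> forall x, P x.
Proof. by move=> h x; rewrite -(num_den x). Qed.

Definition loc_add (x y : localization) : localization :=
  frac (num x * val (den y) + num y * val (den x))
       (denominatorM (den x) (den y)).
Definition loc_opp (x : localization) : localization :=
  frac (- num x) (den x).
Definition loc_mul (x y : localization) : localization :=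
  frac (num x * num y) (denominatorM (den x) (den y)).

Lemma loc_addE a s b t :
  loc_add (frac a s) (frac b t) =
  frac (a * val t + b * val s) (denominatorM s t).
Proof.
have /fracP[u] := num_den (frac a s); have /fracP[v] := num_den (frac b t).
rewrite /loc_add; set x := frac a s; set y := frac b t => hv hu.
apply/fracP; exists (denominatorM u v) => /=.
have -> : val u * val v * ((num x * val (den y) + num y * val (den x)) *
    (val s * val t)) =
  val v * val t * val (den y) * (val u * (num x * val s)) +
  val u * val s * val (den x) * (val v * (num y * val t)) by ring.
by rewrite hu hv /=; ring.
Qed.

Lemma loc_oppE a s : loc_opp (frac a s) = frac (- a) s.
Proof.
have /fracP[u hu] := num_den (frac a s).
by apply/fracP; exists u; rewrite !mulNr !mulrN hu.
Qed.

Lemma loc_mulE a s b t :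
  loc_mul (frac a s) (frac b t) = frac (a * b) (denominatorM s t).
Proof.
have /fracP[u] := num_den (frac a s); have /fracP[v] := num_den (frac b t).
rewrite /loc_mul; set x := frac a s; set y := frac b t => hv hu.
apply/fracP; exists (denominatorM u v) => /=.
have -> : val u * val v * (num x * num y * (val s * val t)) =
  (val u * (num x * val s)) * (val v * (num y * val t)) by ring.
by rewrite hu hv /=; ring.
Qed.

Local Ltac loc_ring :=
  rewrite ?(loc_addE, loc_oppE, loc_mulE);
  apply/fracP; exists denominator1 => /=; ring.

Fact loc_addA : associative loc_add.
Proof. by do 3! elim/localization_ind=> ? ?; loc_ring. Qed.
Fact loc_addC : commutative loc_add.
Proof. by do 2! elim/localization_ind=> ? ?; loc_ring. Qed.
Fact loc_add0 : left_id (frac 0 denominator1) loc_add.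
Proof. by elim/localization_ind=> ? ?; loc_ring. Qed.
Fact loc_addN : left_inverse (frac 0 denominator1) loc_opp loc_add.
Proof. by elim/localization_ind=> ? ?; loc_ring. Qed.

HB.instance Definition _ := GRing.isZmodule.Build localization
  loc_addA loc_addC loc_add0 loc_addN.

Fact loc_mulA : associative loc_mul.
Proof. by do 3! elim/localization_ind=> ? ?; loc_ring. Qed.
Fact loc_mulC : commutative loc_mul.
Proof. by do 2! elim/localization_ind=> ? ?; loc_ring. Qed.
Fact loc_mul1 : left_id (frac 1 denominator1) loc_mul.
Proof. by elim/localization_ind=> ? ?; loc_ring. Qed.
Fact loc_mulDl : left_distributive loc_mul +%R.
Proof.
do 3! elim/localization_ind=> ? ?.
by rewrite -[+%R]/loc_add; loc_ring.
Qed.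

HB.instance Definition _ := GRing.Zmodule_isComPzRing.Build localization
  loc_mulA loc_mulC loc_mul1 loc_mulDl.

Definition loc_map (a : R) : localization := frac a denominator1.

Fact loc_map_zmod_morphism : zmod_morphism loc_map.
Proof.
move=> a b;
  rewrite /loc_map -[RHS]/(loc_add (frac a denominator1)
                                  (loc_opp (frac b denominator1))).
by loc_ring.
Qed.
HB.instance Definition _ := GRing.isZmodMorphism.Build R localization loc_map
  loc_map_zmod_morphism.

Fact loc_map_monoid_morphism : monoid_morphism loc_map.
Proof.
split=> // a b;
  rewrite /loc_map -[RHS]/(loc_mul (frac a denominator1) (frac b denominator1)).
by loc_ring.
Qed.
HB.instance Definition _ := GRing.isMonoidMorphism.Build R localization
  loc_map loc_map_monoid_morphism.

Definition ideal_loc (I : ideal R) : ideal localization :=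
  ideal_gen (loc_map @` I).

End Localization.

(* Heights, dimensions, depths and numbers of generators live in [\bar int], so
   that infinite values (and the dimension -oo of the zero ring) are allowed. *)
Definition enat (n : nat) : \bar int := (n%:Z)%:E.

Section Invariants.
Variable R : comPzRingType.

(* p 0 < p 1 < ... < p n *)
Definition prime_chain (n : nat) (p : nat -> Spec R) : Prop :=
  forall i : nat, (i < n)%N -> p i `<` p i.+1.

Definition krull_dim : \bar int :=
  supremum -oo%E [set enat n | n in [set n | exists p, prime_chain n p]].

Definition height_prime (p : Spec R) : \bar int :=
  supremum -oo%E
    [set enat n | n in
      [set n | exists2 q, prime_chain n q & q n = p :> set R]].

Definition zero_locus (I : ideal R) : set (Spec R) := [set p | I `<=` p].

Definition height (I : ideal R) : \bar int :=
  infimum +oo%E [set height_prime p | p in zero_locus I].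

Definition generated_by (n : nat) (I : ideal R) : Prop :=
  exists t : n.-tuple R, I = ideal_gen [set` t] :> set R.

Definition mu (I : ideal R) : \bar int :=
  infimum +oo%E [set enat n | n in [set n | generated_by n I]].

Definition noetherian : Prop :=
  forall I : ideal R, exists n : nat, generated_by n I.

Definition maximal (m : Spec R) : Prop :=
  forall J : ideal R, m `<=` J -> ~ J 1 -> J `<=` m.

Definition regular_sequence (x : seq R) : Prop :=
  ~ ideal_gen [set` x] 1 /\
  forall i : nat, (i < size x)%N -> forall y : R,
    ideal_gen [set` take i x] (x`_i * y) -> ideal_gen [set` take i x] y.

Definition depth (J : ideal R) : \bar int :=
  supremum -oo%E
    [set enat (size x) | x in [set x | regular_sequence x /\ [set` x] `<=` J]].

End Invariants.

Definition depth_at (R : comPzRingType) (p : Spec R) : \bar int :=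
  depth (ideal_loc p p).

Definition cohen_macaulay (R : comPzRingType) : Prop :=
  noetherian R /\
  forall m : Spec R, maximal m -> depth_at m = krull_dim (localization m).

Definition serre_S (n : nat) (R : comPzRingType) : Prop :=
  forall p : Spec R,
    (Order.min (enat n) (krull_dim (localization p)) <= depth_at p)%E.

(* [s] is an integer in the next definitions since d - 2 may be negative. *)
Definition G_cond (R : comPzRingType) (s : int) (I : ideal R) : Prop :=
  forall p : Spec R, zero_locus I p -> (height_prime p <= (s - 1)%:E)%E ->
    (mu (ideal_loc p I) <= height_prime p)%E.

Definition residual_intersection (R : comPzRingType) (s : nat)
    (I K : ideal R) : Prop :=
  exists a : ideal R,
    [/\ a `<` I, generated_by s a, K = colon a I :> set R
      & (enat s <= height K)%E].

Definition geometric_residual_intersection (R : comPzRingType) (s : nat)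
    (I K : ideal R) : Prop :=
  residual_intersection s I K /\ (enat s < height (ideal_sum I K))%E.

Definition weakly_residually_S2 (R : comPzRingType) (s : int)
    (I : ideal R) : Prop :=
  forall i : nat, i%:Z <= s -> forall K : ideal R,
    geometric_residual_intersection i I K -> serre_S 2 (quotient K).

(* R is its own smallest k-subalgebra containing some finite set. *)
Definition finitely_generated_algebra (k : fieldType) (R : comAlgType k) : Prop :=
  exists s : seq R, forall S : {pred R},
    subalg_closed S -> {subset s <= S} -> forall x : R, x \in S.

(* Main.v *)
(* Choose d general elements x_1, ..., x_d of I and put a_i = (x_1, ..., x_i) and
   K_i = a_i : I.  By G_d, K_i has height at least i, I + K_i has height at least
   i + 1 for i < d, and c = K_d is contained in finitely many primes only, all of
   them maximal.  As R is Cohen-Macaulay and R / K_i is S_2, induction on i shows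
   that the associated primes of K_i have height at most i and that
   I \cap K_i = a_i; so x_(i+1) y in a_i implies y in a_i for y in I and i < d.
   Such sequences generate ideals of linear type, and the symmetric algebra then
   gives, for each r, an exponent N with gamma^N I contained in J whenever gamma
   is in c, J is contained in I and I^(r+1) = J I^r.  The reduction numbers of all
   reductions of I are bounded: reductions are parametrized by matrices, those of
   reduction number at most r form an increasing sequence of open sets, and
   polynomial rings are Noetherian.  Hence a power of c maps I into the core, so
   that I and core(I) agree away from c.  At a maximal ideal m containing c, the
   reductions of I_m contain m^n I_m for some n, so they are localizations of
   reductions of I, and the power of c is absorbed by an element outside m. *)

Require Import Defs.
From mathcomp Require Import all_boot all_order all_algebra.
From mathcomp Require Import boolp classical_sets cardinality constructive_ereal.
From mathcomp Require Import ring.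
From Stdlib Require List.

Set Implicit Arguments.
Unset Strict Implicit.
Unset Printing Implicit Defensive.

Import Order.TTheory GRing.Theory Num.Theory.

Local Open Scope classical_set_scope.
Local Open Scope ring_scope.

(** * Ideals and saturations *)

(** The obstacle is uniformity: the core is an intersection of possibly infinitely many reductions,
    and localization need not commute with it unless one denominator serves all of them. Hence the
    search for one exponent [N] valid for every reduction. A reduction of [I_p] contracts to an
    ideal satisfying the reduction equation only up to a factor [s] outside [p]. The bound for
    [gamma] is therefore proved with such a factor, which covers local and global reductions at
    once. Local statements at [p] are phrased in [R] through [sat p]: an equation in [R_p] is an
    equation in [R] multiplied by an element outside [p]. Quotients are likewise replaced by larger
    ideals. Localizations and quotient rings occur only where hypotheses or the conclusion are
    translated. The symmetric algebra is handled in the same spirit: a linear map from [a] to a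
    quotient of [R] is a set of pairs, and a form is recorded by its values under the inclusion of
    [a] and under this map. *)

Section IdealCalculus.
Variable R : comPzRingType.
Implicit Types (C I J K L : ideal R) (p q : Spec R) (s t : seq R).

Lemma ideal_ext I J : I = J :> set R -> I = J.
Proof.
case: I J => [A A0 AD AM] [B B0 BD BM] /= AB; case: B / AB B0 BD BM => B0 BD BM.
by congr Ideal; exact: Prop_irrelevance.
Qed.

Lemma ideal_eqP I J : I `<=` J -> J `<=` I -> I = J.
Proof. by move=> IJ JI; apply: ideal_ext; apply/seteqP. Qed.

Lemma spec_ext p q : p = q :> set R -> p = q.
Proof.
case: p q => [A A1 AP] [B B1 BP] /= /ideal_ext AB; case: B / AB B1 BP => B1 BP.
by congr PrimeIdeal; exact: Prop_irrelevance.
Qed.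

Lemma ideal_opp I x : I x -> I (- x).
Proof. by move=> Ix; rewrite -mulN1r; exact: ideal_mul. Qed.

Lemma ideal_sub I x y : I x -> I y -> I (x - y).
Proof. by move=> Ix Iy; apply: ideal_add => //; exact: ideal_opp. Qed.

Lemma ideal_mulr I a x : I x -> I (x * a).
Proof. by rewrite mulrC; exact: ideal_mul. Qed.

Lemma ideal_addlr I x y : I x -> I (x + y) -> I y.
Proof. by move=> Ix /(ideal_add (ideal_opp Ix)); rewrite addKr. Qed.

Lemma ideal_addrr I x y : I y -> I (x + y) -> I x.
Proof. by rewrite addrC; exact: ideal_addlr. Qed.

Lemma ideal_full I : I 1 -> forall x, I x.
Proof. by move=> I1 x; rewrite -[x]mulr1; exact: ideal_mul. Qed.

Definition zero_ideal : ideal R.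
Proof.
exists [set 0] => //= [x y -> ->|a x ->]; first by rewrite addr0.
by rewrite mulr0.
Defined.

Definition adjoin C (z : R) : ideal R.
Proof.
exists [set x | exists c a, C c /\ x = c + a * z].
- by exists 0, 0; rewrite mul0r addr0; split=> //; exact: ideal_zero.
- move=> _ _ [c [a [Cc ->]]] [c' [a' [Cc' ->]]]; exists (c + c'), (a + a').
  by split; [exact: ideal_add|ring].
- move=> b _ [c [a [Cc ->]]]; exists (b * c), (b * a).
  by split; [exact: ideal_mul|ring].
Defined.

Lemma adjoin_sub C z : C `<=` adjoin C z.
Proof. by move=> x Cx; exists x, 0; rewrite mul0r addr0. Qed.

Lemma adjoin_mem C z : adjoin C z z.
Proof. by exists 0, 1; rewrite mul1r add0r; split=> //; exact: ideal_zero. Qed.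

Lemma adjoin_min C z J : C `<=` J -> J z -> adjoin C z `<=` J.
Proof.
move=> CJ Jz _ [c [a [Cc ->]]].
by apply: ideal_add; [exact: CJ|exact: ideal_mul].
Qed.

Definition adjoins C s : ideal R := foldl adjoin C s.

Lemma adjoins_rcons C s z : adjoins C (rcons s z) = adjoin (adjoins C s) z.
Proof. by rewrite /adjoins foldl_rcons. Qed.

Lemma adjoins_sub C s : C `<=` adjoins C s.
Proof.
elim: s C => [|z s IH] C x Cx //=.
by apply: IH; exact: adjoin_sub.
Qed.

Lemma adjoins_mem C s z : z \in s -> adjoins C s z.
Proof.
elim: s C => [|y s IH] C //=; rewrite inE => /orP[/eqP->|]; last exact: IH.
by apply: adjoins_sub; exact: adjoin_mem.
Qed.

Lemma adjoins_min C s J :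
  C `<=` J -> (forall z, z \in s -> J z) -> adjoins C s `<=` J.
Proof.
elim: s C => [|y s IH] C CJ sJ //=.
apply: IH => [|z zs]; last by apply: sJ; rewrite inE zs orbT.
by apply: adjoin_min => //; apply: sJ; rewrite inE eqxx.
Qed.

Lemma adjoins_mono C C' s t :
  C `<=` C' -> {subset s <= t} -> adjoins C s `<=` adjoins C' t.
Proof.
move=> CC' st; apply: adjoins_min => [x Cx|z zs].
  by apply: adjoins_sub; exact: CC'.
by apply: adjoins_mem; exact: st.
Qed.

Lemma adjoinsC C z s : adjoins (adjoin C z) s = adjoin (adjoins C s) z.
Proof.
apply: ideal_eqP.
  apply: adjoins_min => [|y ys].
    apply: adjoin_min; last exact: adjoin_mem.
    by move=> x Cx; apply: adjoin_sub; exact: adjoins_sub.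
  by apply: adjoin_sub; exact: adjoins_mem.
apply: adjoin_min; last by apply: adjoins_sub; exact: adjoin_mem.
by apply: adjoins_mono => // x Cx; exact: adjoin_sub.
Qed.

Lemma ideal_gen_mem (A : set R) : A `<=` ideal_gen A.
Proof. by move=> x Ax J; exact. Qed.

Lemma ideal_gen_min (A : set R) J : A `<=` J -> ideal_gen A `<=` J.
Proof. by move=> AJ x; exact. Qed.

Lemma ideal_gen_seq s : ideal_gen [set` s] = adjoins zero_ideal s.
Proof.
apply: ideal_eqP.
  by apply: ideal_gen_min => z /= zs; exact: adjoins_mem.
apply: adjoins_min => [x ->|z zs]; first exact: ideal_zero.
exact: ideal_gen_mem.
Qed.

Lemma ideal_sumP I J x :
  ideal_sum I J x <-> exists a b, [/\ I a, J b & x = a + b].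
Proof.
split; last first.
  move=> [a [b [Ia Jb ->]]]; apply: ideal_add; apply: ideal_gen_mem.
    by left.
  by right.
have idS : exists L : ideal R,
    L = [set x | exists a b, [/\ I a, J b & x = a + b]] :> set R.
  unshelve eexists (Ideal
    (ideal_set := [set x | exists a b, [/\ I a, J b & x = a + b]]) _ _ _) => //.
  - by exists 0, 0; rewrite addr0; split=> //; exact: ideal_zero.
  - move=> _ _ [a [b [Ia Jb ->]]] [a' [b' [Ia' Jb' ->]]]; exists (a + a'), (b + b').
    by split; [exact: ideal_add|exact: ideal_add|ring].
  - move=> c _ [a [b [Ia Jb ->]]]; exists (c * a), (c * b).
    by split; [exact: ideal_mul|exact: ideal_mul|ring].
have [L eL] := idS.
move=> /(_ L); rewrite eL; apply => y [Iy|Jy].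
  by exists y, 0; rewrite addr0; split=> //; exact: ideal_zero.
by exists 0, y; rewrite add0r; split=> //; exact: ideal_zero.
Qed.

Lemma ideal_sum_subl I J : I `<=` ideal_sum I J.
Proof. by move=> x Ix; apply: ideal_gen_mem; left. Qed.

Lemma ideal_sum_subr I J : J `<=` ideal_sum I J.
Proof. by move=> x Jx; apply: ideal_gen_mem; right. Qed.

Lemma ideal_prod_mem I J x y : I x -> J y -> ideal_prod I J (x * y).
Proof. by move=> Ix Jy; apply: ideal_gen_mem; exists x => //; exists y. Qed.

Lemma ideal_prod_min I J L :
  (forall x y, I x -> J y -> L (x * y)) -> ideal_prod I J `<=` L.
Proof. by move=> H; apply: ideal_gen_min => _ [x Ix [y Jy <-]]; exact: H. Qed.

Lemma ideal_prod_mono I I' J J' :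
  I `<=` I' -> J `<=` J' -> ideal_prod I J `<=` ideal_prod I' J'.
Proof.
move=> II' JJ'; apply: ideal_prod_min => x y Ix Jy.
by apply: ideal_prod_mem; [exact: II'|exact: JJ'].
Qed.

Lemma ideal_prod_subr I J : ideal_prod I J `<=` J.
Proof. by apply: ideal_prod_min => x y _; exact: ideal_mul. Qed.

Definition full_ideal : ideal R := ideal_gen setT.

Lemma full_idealP x : full_ideal x.
Proof. exact: ideal_gen_mem. Qed.

Lemma ideal_expX I n x : I x -> ideal_exp I n (x ^+ n).
Proof.
move=> Ix; elim: n => [|n IH]; first exact: full_idealP.
by rewrite exprS; exact: ideal_prod_mem.
Qed.

Definition transporter L (w : R) : ideal R.
Proof.
exists [set x | L (x * w)].
- by rewrite /= mul0r; exact: ideal_zero.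
- by move=> x y /= Lx Ly; rewrite mulrDl; exact: ideal_add.
- by move=> a x /= Lx; rewrite -mulrA; exact: ideal_mul.
Defined.

Lemma ideal_prod_transporter I J L w :
  (forall x y, I x -> J y -> L (x * y * w)) ->
  forall z, ideal_prod I J z -> L (z * w).
Proof. by move=> H; apply: (@ideal_prod_min _ _ (transporter L w)). Qed.

Lemma ideal_prod_gen_min (A B : set R) L :
  (forall x y, A x -> B y -> L (x * y)) ->
  ideal_prod (ideal_gen A) (ideal_gen B) `<=` L.
Proof.
move=> H; apply: ideal_prod_min => x y Ax By.
suff : ideal_gen A `<=` transporter L y by apply.
apply: ideal_gen_min => a Aa /=; rewrite mulrC.
suff : ideal_gen B `<=` transporter L a by apply.
by apply: ideal_gen_min => b Bb /=; rewrite mulrC; exact: H.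
Qed.

(* The contraction to [R] of the extension of [C] to [R_p]. *)
Definition sat p C : ideal R.
Proof.
exists [set x | exists u : R, ~ p u /\ C (u * x)].
- by exists 1; rewrite mulr0; split; [exact: spec_proper|exact: ideal_zero].
- move=> x y [u [pu Cu]] [v [pv Cv]]; exists (u * v); split.
    by case/spec_prime.
  have -> : u * v * (x + y) = v * (u * x) + u * (v * y) by ring.
  by apply: ideal_add; exact: ideal_mul.
- move=> a x [u [pu Cu]]; exists u; split=> //.
  by rewrite mulrCA; exact: ideal_mul.
Defined.

Lemma spec_mulN p u v : ~ p u -> ~ p v -> ~ p (u * v).
Proof. by move=> pu pv /spec_prime[]. Qed.

Lemma spec_expN p u n : ~ p u -> ~ p (u ^+ n).
Proof.
move=> pu; elim: n => [|n IH]; first by rewrite expr0; exact: spec_proper.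
by rewrite exprS; exact: spec_mulN.
Qed.

Lemma spec_exp p u n : p (u ^+ n) -> p u.
Proof. by move=> pu; apply: contrapT => /(@spec_expN _ _ n). Qed.

Lemma sat_sub p C : C `<=` sat p C.
Proof. by move=> x Cx; exists 1; rewrite mul1r; split=> //; exact: spec_proper. Qed.

Lemma sat_mulI p C u x : ~ p u -> sat p C (u * x) -> sat p C x.
Proof.
move=> pu [v [pv Cv]]; exists (v * u); rewrite -mulrA; split=> //.
exact: spec_mulN.
Qed.

Lemma sat_min p C J : C `<=` sat p J -> sat p C `<=` sat p J.
Proof. by move=> CJ x [s [ps /CJ /(sat_mulI ps)]]. Qed.

Lemma sat_idem p C : sat p (sat p C) = sat p C.
Proof. by apply: ideal_eqP; [exact: sat_min|exact: sat_sub]. Qed.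

Lemma sat_mono p C J : C `<=` J -> sat p C `<=` sat p J.
Proof. by move=> CJ; apply: sat_min => x /CJ; exact: sat_sub. Qed.

Lemma sat_spec p q C : p `<=` q -> sat q C `<=` sat p C.
Proof. by move=> pq x [s [qs Cs]]; exists s; split=> // /pq. Qed.

Lemma sat_proper p C : C `<=` p -> sat p C `<=` p.
Proof. by move=> Cp x [s [ps /Cp /spec_prime[]]]. Qed.

Definition saturated p C := sat p C `<=` C.

Lemma sat_saturated p C : saturated p (sat p C).
Proof. by rewrite /saturated sat_idem. Qed.

Lemma saturated_mul p C u x : saturated p C -> ~ p u -> C (u * x) -> C x.
Proof. by move=> Cp pu /sat_sub /(sat_mulI pu) /Cp. Qed.

(** The product of the individual denominators is a common one. Applied to generators, it turns a
    statement over [R_p] into one with a single denominator. *)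
Lemma sat_finite p C s : (forall z, z \in s -> sat p C z) ->
  exists2 u, ~ p u & forall z, z \in s -> C (u * z).
Proof.
elim: s => [|y s IH] Hs; first by exists 1 => //; exact: spec_proper.
have [u pu Hu] := IH (fun z zs => Hs z (mem_behead (s := y :: s) zs)).
have [v [pv Hv]] := Hs y (mem_head _ _).
exists (u * v) => [|z]; first exact: spec_mulN.
rewrite inE => /orP[/eqP->|zs]; first by rewrite -mulrA; exact: ideal_mul.
by rewrite mulrAC; apply: ideal_mulr; exact: Hu.
Qed.

End IdealCalculus.

(** * Associated primes and prime avoidance *)

Definition nonzerodivisor (R : comPzRingType) (C : ideal R) (x : R) : Prop :=
  forall a, C (x * a) -> C a.

Definition associated (R : comPzRingType) (C : ideal R) (p : Spec R) : Prop :=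
  exists w, forall x, p x <-> C (x * w).

Section Noetherian.
Variable R : comPzRingType.
Hypothesis R_noeth : noetherian R.
Implicit Types (C I J K L : ideal R) (p q : Spec R).

Lemma noetherian_gen I : exists s, I = adjoins (zero_ideal R) s.
Proof.
have [n [t It]] := R_noeth I; exists t.
by rewrite -ideal_gen_seq; exact: ideal_ext.
Qed.

Lemma noetherian_chain (F : nat -> ideal R) :
  (forall n, F n `<=` F n.+1) -> exists n, forall m, F m `<=` F n.
Proof.
move=> F_incr.
have F_mono m n : (m <= n)%N -> F m `<=` F n.
  move=> mn; rewrite -(subnK mn); elim: (n - m)%N => [|k IH] // x /IH.
  exact: F_incr.
pose U := ideal_gen (\bigcup_n F n).
have U_F x : U x -> exists n, F n x.
  unshelve epose (V := Ideal (ideal_set := [set x | exists n, F n x]) _ _ _).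
  - by exists 0%N; exact: ideal_zero.
  - move=> y z [m Fy] [n Fz]; exists (maxn m n); apply: ideal_add.
      by apply: F_mono Fy; exact: leq_maxl.
    by apply: F_mono Fz; exact: leq_maxr.
  - by move=> a y [n Fy]; exists n; exact: ideal_mul.
  suff : U `<=` V by apply.
  by apply: ideal_gen_min => y [n _ Fy]; exists n.
have [s Us] := noetherian_gen U.
have [n Fn] : exists n, forall z, z \in s -> F n z.
  have : forall z, z \in s -> U z by move=> z zs; rewrite Us; exact: adjoins_mem.
  elim: s {Us} => [|y s IH] sU; first by exists 0%N.
  have [m Fm] := IH (fun z zs => sU z (mem_behead (s := y :: s) zs)).
  have [n Fn] := U_F _ (sU y (mem_head _ _)).
  exists (maxn m n) => z; rewrite inE => /orP[/eqP->|/Fm].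
    by apply: F_mono Fn; exact: leq_maxr.
  by apply: F_mono; exact: leq_maxl.
exists n => m x Fx; have : U x by apply: ideal_gen_mem; exists m.
rewrite Us; suff : adjoins (zero_ideal R) s `<=` F n by apply.
by apply: adjoins_min => // y ->; exact: ideal_zero.
Qed.

Lemma noetherian_ind (P : ideal R -> Prop) :
  (forall I, (forall J, I `<=` J -> ~ J `<=` I -> P J) -> P I) ->
  forall I, P I.
Proof.
move=> step I0; apply: contrapT => PI0.
have /choice[f Hf] : forall I, exists J,
    ~ P I -> [/\ I `<=` J, ~ J `<=` I & ~ P J].
  move=> I; have [PI|PI] := pselect (P I); first by exists I.
  apply: contrapT => H; apply: PI; apply: step => J IJ JI.
  by apply: contrapT => PJ; apply: H; exists J.
pose F n := iter n f I0.
have PF n : ~ P (F n) by elim: n => [|n /Hf[]].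
have [|n Fn] := @noetherian_chain F; first by move=> n; have [] := Hf _ (PF n).
by have [_ + _] := Hf _ (PF n); apply; exact: (Fn n.+1).
Qed.

Lemma associated_sub C p : associated C p -> C `<=` p.
Proof. by move=> [w pw] x Cx; apply/pw; exact: ideal_mulr. Qed.

(** Noetherian induction on [T = C : w]: if [T] contains [x * y] but neither factor, then
    [C : (y * w)] is strictly larger, as it contains [x]. *)
Lemma associated_exists C w : ~ C w ->
  exists2 p, associated C p & forall x, C (x * w) -> p x.
Proof.
move eT : (transporter C w) => T; elim/noetherian_ind: T w eT => T IH w eT Cw.
have [T_prime|] := pselect (forall x y, T (x * y) -> T x \/ T y).
  have T1 : ~ T 1 by rewrite -eT /= mul1r.
  by exists (PrimeIdeal T1 T_prime) => [|x Cx]; [exists w => x|]; rewrite /= -eT.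
move=> /existsNP[x /existsNP[y /not_implyP[Txy /not_orP[Tx Ty]]]].
have [||||p Cp Hp] := IH (transporter C (y * w)) _ _ (y * w).
- by move=> z; rewrite -eT /= => Cz; rewrite mulrCA; exact: ideal_mul.
- by move=> H; apply/Tx/H; move: Txy; rewrite -eT /= mulrA.
- by [].
- by move: Ty; rewrite -eT.
- by exists p => // z Cz; apply: Hp; rewrite mulrCA; exact: ideal_mul.
Qed.

(** The submodule of [R / C] spanned by [w0] is [R / p0]. For [q = C : a], either a nonzero multiple
    of [a] lies in this submodule, whence [q = p0], or [q] is associated to [adjoin C w0]. *)
Lemma associated_finite C :
  exists Ps : seq (Spec R), forall p, associated C p -> List.In p Ps.
Proof.
elim/noetherian_ind: C => C IH.
have [C1|C1] := pselect (C 1).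
  by exists [::] => p [w pw]; case: (@spec_proper _ p); apply/pw; exact: ideal_full.
have [p0 [w0 p0w0] _] := associated_exists C1.
have Cw0 : ~ C w0 by move: (@spec_proper _ p0) => + Cw0; apply; apply/p0w0; rewrite mul1r.
have [|H|Ps HPs] := IH (adjoin C w0); first exact: adjoin_sub.
  by apply/Cw0/H; exact: adjoin_mem.
exists (p0 :: Ps) => q [a qa] /=.
have Ca : ~ C a by move: (@spec_proper _ q) => + Ca; apply; apply/qa; rewrite mul1r.
have [[b [Cba [c [r [Cc ba]]]]]|nb] :=
    pselect (exists b, ~ C (b * a) /\ adjoin C w0 (b * a)).
  left; apply: spec_ext; apply/seteqP.
  have qb : ~ q b by rewrite qa.
  have key x : C (x * (r * w0)) <-> C (x * (b * a)).
    have Cxc : C (x * c) by exact: ideal_mul.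
    by rewrite ba mulrDr; split=> [|/(ideal_addlr Cxc)//]; exact: ideal_add.
  have p0r : ~ p0 r by move=> /p0w0 H; apply: Cba; rewrite ba; exact: ideal_add.
  split=> x.
    move=> /p0w0 Hx; apply: contrapT => qx; apply: (spec_mulN qx qb).
    apply/qa; rewrite -mulrA; apply/key.
    by rewrite mulrCA; exact: ideal_mul.
  move=> /qa Hx; apply: contrapT => p0x; apply: (spec_mulN p0x p0r).
  apply/p0w0; rewrite -mulrA; apply/key.
  by rewrite mulrCA; exact: ideal_mul.
right; apply: HPs; exists a => x; split=> [/qa|Hx]; first exact: adjoin_sub.
by apply/qa; apply: contrapT => Cx; apply: nb; exists x.
Qed.

Lemma associated_saturated p C q : saturated p C -> associated C q -> q `<=` p.
Proof.
move=> Cp [w qw] x /qw Cx; apply: contrapT => px.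
apply: (@spec_proper _ q); apply/qw; rewrite mul1r.
exact: (saturated_mul Cp px Cx).
Qed.

(** As [q] is finitely generated, a common denominator [u] of its generators can be moved into the
    witness: [q = C : (u * w)]. *)
Lemma associated_sat p C q : associated (sat p C) q -> associated C q.
Proof.
move=> [w qw]; have [s qs] := noetherian_gen q.
have [|u pu Hu] := @sat_finite _ p (transporter C w) s.
  move=> z zs; have /qw[v [pv Cv]] : q z by rewrite qs; exact: adjoins_mem.
  by exists v; split=> //=; rewrite -mulrA.
exists (u * w) => x; split=> [|Cx]; last first.
  by apply/qw; exists u; split=> //; rewrite mulrCA.
suff : q `<=` transporter C (u * w) by apply.
rewrite qs; apply: adjoins_min => [y ->|z zs]; first exact: ideal_zero.
by rewrite /= mulrCA mulrA; exact: Hu.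
Qed.

(** Used with [w = 1]: a prime containing [C] contains an associated prime of [C]. *)
Lemma associated_below C p w : (forall x, C (x * w) -> p x) ->
  exists q, [/\ associated C q, q `<=` p & forall x, C (x * w) -> q x].
Proof.
move=> Cp; have [|q Cq Hq] := @associated_exists (sat p C) w.
  by move=> [u [pu /Cp]].
exists q; split.
- exact: associated_sat Cq.
- by apply: associated_saturated Cq; exact: sat_saturated.
- by move=> x Cx; apply: Hq; exact: sat_sub.
Qed.

Lemma associated_nzd C p x : associated C p -> nonzerodivisor C x -> ~ p x.
Proof.
move=> [w pw] Cx /pw /Cx Cw; apply: (@spec_proper _ p).
by apply/pw; rewrite mul1r.
Qed.

(** Prime avoidance for arbitrary ideals: primeness is traded for an infinite field, over which no
    space is a finite union of proper subspaces. *)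
Definition avoidance : Prop := forall J (Ls : seq (ideal R)),
  (forall L, List.In L Ls -> ~ J `<=` L) ->
  exists2 x, J x & forall L, List.In L Ls -> ~ L x.

(** Plays the role of a dense open condition: finitely many of them can be imposed on a single
    element of [J]. *)
Definition generic J (P : R -> Prop) : Prop := exists Ls : seq (ideal R),
  (forall L, List.In L Ls -> ~ J `<=` L) /\
  forall x, J x -> (forall L, List.In L Ls -> ~ L x) -> P x.

Lemma generic_ex J P : avoidance -> generic J P -> exists2 x, J x & P x.
Proof.
by move=> avoid [Ls [JLs HP]]; have [x Jx HJ] := avoid _ _ JLs; exists x => //; exact: HP.
Qed.

Lemma generic_true J (P : R -> Prop) : (forall x, J x -> P x) -> generic J P.
Proof. by move=> HP; exists [::]; split=> [L []|x Jx _]; exact: HP. Qed.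

Lemma generic_impl J (P Q : R -> Prop) :
  (forall x, J x -> P x -> Q x) -> generic J P -> generic J Q.
Proof.
by move=> PQ [Ls [HL HP]]; exists Ls; split=> // x Jx Hx; apply: PQ => //; exact: HP.
Qed.

Lemma generic_and J (P Q : R -> Prop) :
  generic J P -> generic J Q -> generic J (fun x => P x /\ Q x).
Proof.
move=> [Ls [HL HP]] [Ms [HM HQ]]; exists (Ls ++ Ms); split=> [L|x Jx Hx].
  by move=> /(@List.in_app_or _ Ls Ms)[/HL|/HM].
split; [apply: HP|apply: HQ] => // L HLs; apply: Hx.
  by apply: (@List.in_or_app _ Ls Ms); left.
by apply: (@List.in_or_app _ Ls Ms); right.
Qed.

Lemma generic_avoid J L : ~ J `<=` L -> generic J (fun x => ~ L x).
Proof.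
move=> JL; exists [:: L]; split=> [M [<-|[]] //|x Jx]; apply.
by left.
Qed.

Lemma generic_all (T : Type) (ts : seq T) J (P : T -> R -> Prop) :
  (forall t, List.In t ts -> generic J (P t)) ->
  generic J (fun x => forall t, List.In t ts -> P t x).
Proof.
elim: ts => [|t ts IH] HP; first exact: generic_true.
have [|] := IH; first by move=> t' ht'; apply: HP; right.
move=> Ls HLs; have Ht : generic J (P t) by apply: HP; left.
apply: generic_impl (generic_and Ht (ex_intro _ Ls HLs)) => x _ [Ptx HPx] t'.
by case=> [<-|/HPx].
Qed.

Lemma generic_ltn (n : nat) J (P : nat -> R -> Prop) :
  (forall i, (i < n)%N -> generic J (P i)) ->
  generic J (fun x => forall i, (i < n)%N -> P i x).
Proof.
elim: n => [|n IH] HP; first exact: generic_true.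
have HI : generic J (fun x => forall i, (i < n)%N -> P i x).
  by apply: IH => i ilt; apply: HP; exact: ltnW.
apply: generic_impl (generic_and (HP n (leqnn _)) HI) => x _ [Pn Plt] i.
by rewrite ltnS leq_eqVlt => /orP[/eqP->|/Plt].
Qed.

Lemma generic_associated C J (P : Spec R -> R -> Prop) :
  (forall p, associated C p -> generic J (P p)) ->
  generic J (fun x => forall p, associated C p -> P p x).
Proof.
move=> HP; have [Ps HPs] := associated_finite C.
apply: (generic_impl (P := fun x => forall p, List.In p Ps ->
  associated C p -> P p x)); first by move=> x _ Hx p Cp; apply: Hx => //; exact: HPs.
apply: generic_all => p _; have [Cp|Cp] := pselect (associated C p).
  by apply: generic_impl (HP p Cp).
exact: generic_true.
Qed.

Lemma generic_nzd C J : (forall p, associated C p -> ~ J `<=` p) ->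
  generic J (nonzerodivisor C).
Proof.
move=> HJ; have := @generic_associated C J (fun p x => ~ p x).
move=> /(_ _)-/(_ (fun p Cp => generic_avoid (HJ p Cp))).
apply: generic_impl => x Jx Hx a Cxa; apply: contrapT => Ca.
by have [p Cp Hp] := associated_exists Ca; apply: (Hx p Cp); exact: Hp.
Qed.

Lemma nzd_generic C J x : J x -> nonzerodivisor C x -> generic J (nonzerodivisor C).
Proof.
move=> Jx Cx; apply: generic_nzd => p Cp Jp.
by apply: (associated_nzd Cp Cx); exact: Jp.
Qed.

Definition adjoin_by (P C : ideal R) (z : R) : ideal R.
Proof.
exists [set x | exists c a, [/\ C c, P a & x = c + a * z]].
- by exists 0, 0; rewrite mul0r addr0; split=> //; exact: ideal_zero.
- move=> _ _ [c [a [Cc Pa ->]]] [c' [a' [Cc' Pa' ->]]]; exists (c + c'), (a + a').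
  by split; [exact: ideal_add|exact: ideal_add|ring].
- move=> b _ [c [a [Cc Pa ->]]]; exists (b * c), (b * a).
  by split; [exact: ideal_mul|exact: ideal_mul|ring].
Defined.

Lemma ideal_prod_cons P g s :
  ideal_prod P (adjoins (zero_ideal R) (g :: s)) `<=`
  adjoin_by P (ideal_prod P (adjoins (zero_ideal R) s)) g.
Proof.
rewrite [adjoins _ _]adjoinsC.
apply: ideal_prod_min => x _ Px [c [a [Cc ->]]].
exists (x * c), (x * a); split; [exact: ideal_prod_mem|exact: ideal_mulr|ring].
Qed.

(** Elimination takes the place of the determinant: in the relation for [g] its coefficient [u - a]
    is outside [p], so [g] can be substituted into the relations for the other generators. *)
Lemma nakayama_seq p L s :
  (forall g, g \in s ->
    sat p (ideal_sum L (ideal_prod p (adjoins (zero_ideal R) s))) g) ->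
  forall g, g \in s -> sat p L g.
Proof.
elim: s => [|g s IH] Hs //.
set M := ideal_sum L (ideal_prod p (adjoins (zero_ideal R) s)).
have split_head x : sat p (ideal_sum L (ideal_prod p (adjoins (zero_ideal R) (g :: s)))) x ->
    exists u a, [/\ ~ p u, p a & M (u * x - a * g)].
  move=> [u [pu /ideal_sumP[l [y [Ll /ideal_prod_cons[c [a [Cc pa ->]]] uxE]]]]].
  exists u, a; split=> //; apply/ideal_sumP; exists l, c; split=> //.
  by rewrite uxE; ring.
have [u [a [pu pa Mg]]] := split_head _ (Hs g (mem_head _ _)).
have pv : ~ p (u - a) by move=> /(ideal_add pa); rewrite addrC subrK.
have Mvg : M ((u - a) * g) by rewrite mulrBl.
have Ms h : h \in s -> sat p L h.
  apply: IH => {}h hs; have [|u' [a' [pu' pa' Mh]]] := split_head h.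
    by apply: Hs; rewrite inE hs orbT.
  exists ((u - a) * u'); split; first exact: spec_mulN.
  have -> : (u - a) * u' * h = (u - a) * (u' * h - a' * g) + a' * ((u - a) * g) by ring.
  by apply: ideal_add; exact: ideal_mul.
move=> h; rewrite inE => /orP[/eqP->{h}|]; last exact: Ms.
apply: (sat_mulI pv); move: Mvg => /ideal_sumP[l [y [Ll Hy ->]]].
apply: ideal_add; first exact: sat_sub.
have : adjoins (zero_ideal R) s `<=` sat p L.
  by apply: adjoins_min => // _ ->; exact: ideal_zero.
by apply; exact: ideal_prod_subr Hy.
Qed.

Lemma nakayama p L J :
  J `<=` sat p (ideal_sum L (ideal_prod p J)) -> J `<=` sat p L.
Proof.
have [s ->] := noetherian_gen J => HJ; apply: adjoins_min => [_ ->|].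
  exact: ideal_zero.
by apply: nakayama_seq => g gs; apply: HJ; exact: adjoins_mem.
Qed.

End Noetherian.

(** * Regular sequences and heights in Cohen-Macaulay rings *)

Section RegularSequences.
Variable R : comPzRingType.
Hypothesis R_noeth : noetherian R.
Hypothesis R_avoid : avoidance R.
Implicit Types (C D I J K L : ideal R) (p q m : Spec R) (ys us : seq R).

(* [ys] maps to a regular sequence of [(R / C)_p] contained in [p R_p]. *)
Fixpoint regular_at p C ys : Prop :=
  if ys is y :: ys' then
    [/\ p y, nonzerodivisor (sat p C) y & regular_at p (adjoin C y) ys']
  else True.

Lemma regular_at_rcons p C ys y : regular_at p C (rcons ys y) <->
  [/\ regular_at p C ys, p y & nonzerodivisor (sat p (adjoins C ys)) y].
Proof.
elim: ys C => [|z ys IH] C /=; first by split=> -[].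
by split=> [[pz Cz /IH[]]|[[pz Cz ?] ? ?]]; split=> //; apply/IH.
Qed.

Lemma regular_at_mem p C ys : regular_at p C ys -> forall y, y \in ys -> p y.
Proof.
elim: ys C => [|z ys IH] C //= [pz _ /IH H] y.
by rewrite inE => /orP[/eqP->|/H].
Qed.

Lemma nzd_sat_spec p q C y : p `<=` q ->
  nonzerodivisor (sat q C) y -> nonzerodivisor (sat p C) y.
Proof.
move=> pq Cy a [s [ps Ca]]; apply: (sat_mulI ps).
by apply: (sat_spec pq); apply: Cy; apply: sat_sub; rewrite mulrCA.
Qed.

Lemma regular_at_spec p q C ys : p `<=` q -> (forall y, y \in ys -> p y) ->
  regular_at q C ys -> regular_at p C ys.
Proof.
move=> pq; elim: ys C => [|z ys IH] C //= Hp [_ Cz Hys]; split.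
- by apply: Hp; rewrite mem_head.
- exact: nzd_sat_spec Cz.
- by apply: IH => // y yys; apply: Hp; rewrite inE yys orbT.
Qed.

Fixpoint nzd_along p C ys (z : R) : Prop :=
  nonzerodivisor (sat p C) z /\
  if ys is y :: ys' then nzd_along p (adjoin C y) ys' z else True.

Lemma nzd_along_last p C ys z :
  nzd_along p C ys z -> nonzerodivisor (sat p (adjoins C ys)) z.
Proof. by elim: ys C => [|y ys IH] C /= [Cz] // /IH. Qed.

(** At each stage the next element of the sequence is a nonzerodivisor in [p], so [p] lies in no
    associated prime of that stage. *)
Lemma generic_nzd_along p C ys y : regular_at p C (rcons ys y) ->
  generic p (nzd_along p C ys).
Proof.
elim: ys C => [|z ys IH] C /= [pz Cz Hys].
  by apply: generic_impl (nzd_generic R_noeth pz Cz).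
exact: generic_and (nzd_generic R_noeth pz Cz) (IH _ Hys).
Qed.

(** From [y a = b z] modulo [C], regularity of [z] modulo [y] makes [b] a multiple [b' y];
    cancelling [y] leaves [a = b' z]. All equations hold up to denominators. *)
Lemma nzd_swap p C y z : nonzerodivisor (sat p C) y ->
  nonzerodivisor (sat p (adjoin C y)) z ->
  nonzerodivisor (sat p (adjoin C z)) y.
Proof.
move=> Cy Cz a [s [ps [c [b [Cc sE]]]]].
have /Cz[s' [ps' [c' [b' [Cc' s'E]]]]] : sat p (adjoin C y) (z * b).
  by apply: sat_sub; exists (- c), (s * a); split; [exact: ideal_opp|ring: sE].
have /Cy[s2 [ps2 Cs2]] : sat p C (y * (s' * s * a - z * b')).
  apply: sat_sub.
  have -> : y * (s' * s * a - z * b') = s' * (s * (y * a)) - z * (b' * y) by ring.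
  have -> : b' * y = s' * b - c' by rewrite s'E addrC addKr.
  rewrite sE; have -> : s' * (c + b * z) - z * (s' * b - c') = s' * c + z * c' by ring.
  by apply: ideal_add; exact: ideal_mul.
exists (s2 * s' * s); split; first by do 2! apply: spec_mulN => //.
exists (s2 * (s' * s * a - z * b')), (s2 * b'); split=> //; ring.
Qed.

Lemma regular_at_swap p C ys z : nzd_along p C ys z ->
  regular_at p C ys -> regular_at p (adjoin C z) ys.
Proof.
elim: ys C => [|y ys IH] C //= [Cz Hz] [py Cy Hys]; split=> //.
  by apply: nzd_swap => //; move: Hz; case: (ys) => [|? ?] /= [].
have -> : adjoin (adjoin C z) y = adjoin (adjoin C y) z.
  exact: (adjoinsC C z [:: y]).
exact: IH.
Qed.

(** Both socles are Ext^1 of the residue field with values in [(R / D)_p]; explicitly, [w'] is the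
    quotient in [z w = w' y] modulo [D]. *)
Lemma socle_exchange p D y z w : nonzerodivisor (sat p D) y ->
  nonzerodivisor (sat p D) z -> p z ->
  ~ sat p (adjoin D y) w -> (forall x, p x -> sat p (adjoin D y) (x * w)) ->
  exists2 w', ~ sat p (adjoin D z) w' &
    forall x, p x -> sat p (adjoin D z) (x * w').
Proof.
move=> Dy Dz pz Dw Hw; have [s [ps [d [w' [Dd sE]]]]] := Hw z pz.
exists w' => [[s' [ps' [d' [b [Dd' s'E]]]]]|x /Hw[s1 [ps1 [d1 [b1 [Dd1 s1E]]]]]].
  have /Dz[s2 [ps2 Ds2]] : sat p D (z * (s' * s * w - y * b)).
    apply: sat_sub.
    have -> : z * (s' * s * w - y * b) = s' * (s * (z * w)) - y * (b * z) by ring.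
    have -> : b * z = s' * w' - d' by rewrite s'E addrC addKr.
    rewrite sE; have -> : s' * (d + w' * y) - y * (s' * w' - d') = s' * d + y * d' by ring.
    by apply: ideal_add; exact: ideal_mul.
  apply: Dw; exists (s2 * s' * s); split; first by do 2! apply: spec_mulN => //.
  by exists (s2 * (s' * s * w - y * b)), (s2 * b); split=> //; ring.
have /Dy[s2 [ps2 Ds2]] : sat p D (y * (s1 * x * w' - s * z * b1)).
  apply: sat_sub.
  have -> : y * (s1 * x * w' - s * z * b1) = s1 * x * (w' * y) - s * z * (b1 * y) by ring.
  have -> : b1 * y = s1 * (x * w) - d1 by rewrite s1E addrC addKr.
  have -> : w' * y = s * (z * w) - d by rewrite sE addrC addKr.
  have -> : s1 * x * (s * (z * w) - d) - s * z * (s1 * (x * w) - d1) =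
    (- (s1 * x)) * d + (s * z) * d1 by ring.
  by apply: ideal_add; exact: ideal_mul.
exists (s2 * s1); split; first exact: spec_mulN.
by exists (s2 * (s1 * x * w' - s * z * b1)), (s2 * s * b1); split=> //; ring.
Qed.

(* Both sequences are changed so as to end with a common [z], regular modulo all
   their proper initial segments; [z] is then moved to the front and divided out. *)
Lemma regular_at_size p C ys us w : regular_at p C ys -> regular_at p C us ->
  ~ sat p (adjoins C ys) w -> (forall x, p x -> sat p (adjoins C ys) (x * w)) ->
  (size us <= size ys)%N.
Proof.
elim: {ys}(size ys) {-2}ys (erefl (size ys)) C us w => [|n IH] ys sz C us w.
  move: sz => /size0nil -> /= _; case: us => [|u us] //= [pu Cu _] Cw /(_ u pu)/Cu.
  by move/Cw.
case/lastP: ys sz => [|ys y] //; rewrite size_rcons => -[sz].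
case/lastP: us => [|us u] // Hys Hus; rewrite adjoins_rcons => Dw Hw.
have [z pz [Hzy Hzu]] :=
  generic_ex R_avoid (generic_and (generic_nzd_along Hys) (generic_nzd_along Hus)).
have /regular_at_rcons[Rys py Dy] := Hys; have /regular_at_rcons[Rus _ _] := Hus.
have [w' Dw' Hw'] := socle_exchange Dy (nzd_along_last Hzy) pz Dw Hw.
rewrite size_rcons ltnS.
by apply: (IH ys sz (adjoin C z) us w'); rewrite ?adjoinsC //; exact: regular_at_swap.
Qed.

(** Heights enter only through lower bounds; [ht p <= n] is written [~ height_geq n.+1 p]. *)
Fixpoint height_geq (n : nat) (p : Spec R) : Prop :=
  if n is n'.+1 then exists2 q : Spec R, q `<` p & height_geq n' q else True.

Fixpoint climbs (n : nat) (q m : Spec R) : Prop :=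
  if n is n'.+1 then exists2 q' : Spec R, q `<` q' & climbs n' q' m else q `<=` m.

Lemma height_geq_sub n p q : p `<=` q -> height_geq n p -> height_geq n q.
Proof.
case: n => [|n] //= pq [r [rp pr] Hr]; exists r => //; split.
  exact: subset_trans pq.
by move=> qr; apply: pr; exact: subset_trans qr.
Qed.

Lemma height_geq_leq n n' p : (n' <= n)%N -> height_geq n p -> height_geq n' p.
Proof.
elim: n n' p => [|n IH] [|n'] p //= nn' [q qp Hq]; exists q => //.
exact: IH Hq.
Qed.

Lemma height_geq_climbs a b q m :
  height_geq a q -> climbs b q m -> height_geq (a + b) m.
Proof.
elim: b a q => [|b IH] a q; first by rewrite addn0 => Hq /height_geq_sub; apply.
by move=> Hq [q' qq' Hq']; rewrite -addSnnS; apply: IH Hq'; exists q.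
Qed.

(** The inequality depth <= dim R/q for an associated prime [q], with an explicit chain. Each step
    adjoins some [z] in [m] regular modulo [ys] and finds an associated prime of the larger ideal
    above [q] and [z]. *)
Lemma regular_at_climbs m C us ys q k : regular_at m C us ->
  regular_at m C ys -> associated (sat m (adjoins C ys)) q ->
  (k + size ys <= size us)%N -> climbs k q m.
Proof.
move=> Hus; elim: k ys q => [|k IH] ys q Hys Dq sz.
  by apply: associated_saturated Dq; exact: sat_saturated.
set D := sat m (adjoins C ys) in Dq.
have [|z mz Dz] := generic_ex R_avoid (@generic_nzd _ R_noeth D m _).
  (* Otherwise [m] lies in an associated prime, whose witness is a socle element modulo [ys], and no
     regular sequence is longer than [ys]. *)
  move=> Q [w Qw] mQ; suff : (size us <= size ys)%N.
    by rewrite leqNgt (leq_trans _ sz) // addSn ltnS leq_addl.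
  apply: (regular_at_size (w := w) Hys Hus) => [Dw|x /mQ/Qw //].
  by apply: (@spec_proper _ Q); apply/Qw; rewrite mul1r.
have [w0 qw0] := Dq.
have Dw0 : ~ D w0 by move=> H; apply: (@spec_proper _ q); apply/qw0; rewrite mul1r.
pose W := colon D q; pose E := adjoin (adjoins C ys) z.
(* If [W] were contained in [(ys, z)] locally, regularity of [z] would give [W = D + z W], hence
   [W = D] by Nakayama, against [w0]. *)
have [w Ww Ew] : exists2 w, W w & ~ sat m E w.
  apply: contrapT => HW; apply: Dw0.
  have WE : W `<=` sat m E by move=> w Ww; apply: contrapT => Ew; apply: HW; exists w.
  have : W `<=` sat m D.
    apply: (nakayama R_noeth) => w Ww; have [s [ms [c [b [Cc sE]]]]] := WE w Ww.
    exists s; split=> //; rewrite sE; apply/ideal_sumP; exists c, (b * z).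
    split=> //; first exact: sat_sub.
    rewrite mulrC; apply: ideal_prod_mem => // x qx; apply: Dz.
    have -> : z * (b * x) = x * (b * z) by ring.
    have -> : b * z = s * w - c by rewrite sE addrC addKr.
    rewrite mulrBr; apply: ideal_sub; last by apply: ideal_mul; exact: sat_sub.
    by rewrite mulrCA [x * w]mulrC; apply: ideal_mul; exact: Ww.
  rewrite sat_idem; apply => x /qw0; by rewrite mulrC.
have [q' Eq' Hq'] := associated_exists R_noeth Ew.
exists q'.
  split=> [x qx|H].
    apply: Hq'; apply: (sat_mono (C := adjoins C ys)); first exact: adjoin_sub.
    by rewrite mulrC; exact: Ww.
  apply: (associated_nzd Dq Dz); apply: H; apply: Hq'; apply: sat_sub.
  by apply: ideal_mulr; exact: adjoin_mem.
apply: (IH (rcons ys z)); rewrite ?adjoins_rcons //.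
  by apply/regular_at_rcons.
by rewrite size_rcons addnS -addSn.
Qed.

Definition cohen_macaulay_at p : Prop := exists2 us,
  regular_at p (zero_ideal R) us & forall n, height_geq n p -> (n <= size us)%N.

(** A chain of length [n] below [q] continues by [size us - size ys] steps up to [m], and the total
    is at most [size us]. *)
Lemma unmixed m ys q n : cohen_macaulay_at m ->
  regular_at m (zero_ideal R) ys ->
  associated (sat m (adjoins (zero_ideal R) ys)) q ->
  height_geq n q -> (n <= size ys)%N.
Proof.
move=> [us Hus m_us] Hys Dq Hq.
have qm : q `<=` m by apply: associated_saturated Dq; exact: sat_saturated.
have [sz|sz] := leqP (size ys) (size us); last first.
  by apply: leq_trans (ltnW sz); apply: m_us; exact: height_geq_sub Hq.
have := height_geq_climbs Hq (@regular_at_climbs m _ us ys q (size us - size ys) Hus Hys Dq _).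
rewrite subnK // => /(_ (leqnn _))/m_us.
by rewrite -{2}(subnKC sz) leq_add2r.
Qed.

(** As long as fewer elements are chosen than the height of [p], [unmixed] keeps [p] out of all
    associated primes, so the sequence can be extended inside [p]. *)
Lemma regular_at_height m p n : cohen_macaulay_at m -> p `<=` m ->
  height_geq n p -> exists ys, [/\ regular_at m (zero_ideal R) ys,
    (forall y, y \in ys -> p y) & size ys = n].
Proof.
move=> CMm pm; elim: n => [|n IH] Hp; first by exists [::].
have [ys [Hys pys sz]] := IH (height_geq_leq (leqnSn n) Hp).
have [|z pz Dz] := generic_ex R_avoid
    (@generic_nzd _ R_noeth (sat m (adjoins (zero_ideal R) ys)) p _).
  move=> q Dq pq; have := unmixed CMm Hys Dq (height_geq_sub pq Hp).
  by rewrite sz ltnn.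
exists (rcons ys z); split; last by rewrite size_rcons sz.
  by apply/regular_at_rcons; split=> //; exact: pm.
by move=> y; rewrite mem_rcons inE => /orP[/eqP->|/pys].
Qed.

Lemma height_max p h : (forall n, height_geq n p -> (n <= h)%N) ->
  exists2 g, height_geq g p & forall n, height_geq n p -> (n <= g)%N.
Proof.
move=> Hh; have ex : exists n, `[< height_geq n p >] by exists 0%N; apply/asboolP.
have ub n : `[< height_geq n p >] -> (n <= h)%N by move/asboolP/Hh.
case: (ex_maxnP ex ub) => g /asboolP Hg gmax; exists g => // n Hn.
by apply: gmax; apply/asboolP.
Qed.

Lemma cohen_macaulay_at_sub m p :
  cohen_macaulay_at m -> p `<=` m -> cohen_macaulay_at p.
Proof.
move=> CMm pm; have [us _ m_us] := CMm.
have [|g Hg gmax] := @height_max p (size us).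
  by move=> n Hn; apply: m_us; exact: height_geq_sub Hn.
have [ys [Hys pys sz]] := regular_at_height CMm pm Hg.
by exists ys; [exact: regular_at_spec Hys|rewrite sz].
Qed.

Lemma regular_at_height_geq q C ys : C `<=` q -> regular_at q C ys ->
  height_geq (size ys) q.
Proof.
elim/last_ind: ys q => [|ys y IH] q Cq //.
rewrite size_rcons => /regular_at_rcons[Hys qy Dy].
have Dq : adjoins C ys `<=` q by apply: adjoins_min => //; exact: regular_at_mem Hys.
have [q' Dq' _] := @associated_exists _ R_noeth (sat q (adjoins C ys)) 1
  (fun H => @spec_proper _ q (sat_proper Dq H)).
have q'q : q' `<=` q by apply: associated_saturated Dq'; exact: sat_saturated.
have Cq' x : adjoins C ys x -> q' x.
  by move=> Hx; apply: (associated_sub Dq'); exact: sat_sub.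
exists q'.
  by split=> // H; apply: (associated_nzd Dq' Dy); exact: H.
apply: IH => [x Cx|]; first by apply: Cq'; exact: adjoins_sub.
by apply: regular_at_spec Hys => // z zys; apply: Cq'; exact: adjoins_mem.
Qed.

(** Catenarity: a longest regular sequence in [p'] has [p'] as an associated prime. If the height
    rose by more than one, [regular_at_climbs] would lead from [p'] to [p] in two strict steps. *)
Lemma height_adjacent p' p i : cohen_macaulay_at p -> p' `<` p ->
  (forall q : Spec R, p' `<` q -> ~ q `<` p) ->
  (forall n, height_geq n p' -> (n <= i)%N) ->
  forall n, height_geq n p -> (n <= i.+1)%N.
Proof.
move=> CMp p'p adj p'i; have [g Hg gmax] := height_max p'i.
have [ys [Hys p'ys sz]] := regular_at_height CMp p'p.1 Hg.
pose D := sat p (adjoins (zero_ideal R) ys).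
have [q Dq p'q] : exists2 q, associated D q & p' `<=` q.
  apply: contrapT => H.
  have [|z p'z Dz] := generic_ex R_avoid (@generic_nzd _ R_noeth D p' _).
    by move=> q Dq p'q; apply: H; exists q.
  have Hz : regular_at p (zero_ideal R) (rcons ys z).
    by apply/regular_at_rcons; split=> //; exact: p'p.1.
  have : height_geq g.+1 p'.
    rewrite -sz -(size_rcons ys z).
    apply: (@regular_at_height_geq p' (zero_ideal R)) => [_ ->|].
      exact: ideal_zero.
    apply: regular_at_spec Hz => //; first exact: p'p.1.
    by move=> y; rewrite mem_rcons inE => /orP[/eqP->|/p'ys].
  by move/gmax; rewrite ltnn.
have qp' : q `<=` p'.
  apply: contrapT => qp'; have : height_geq g.+1 q by exists p'.
  by move/(unmixed CMp Hys Dq); rewrite sz ltnn.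
have eq : q = p' by apply: spec_ext; apply/seteqP.
rewrite eq in Dq; have [us Hus p_us] := CMp.
suff us_g : (size us <= g.+1)%N.
  by move=> n /p_us /leq_trans; apply; apply: leq_trans us_g _; rewrite ltnS p'i.
rewrite leqNgt; apply/negP => us_g.
have [|q1 p'q1 [q2 [q12 q21] q2p]] := @regular_at_climbs p _ us ys p' 2 Hus Hys Dq.
  by rewrite sz.
apply: (adj q1 p'q1); split; first exact: subset_trans q2p.
by move=> pq1; apply: q21; exact: subset_trans pq1.
Qed.

End RegularSequences.

(** * General elements and residual intersections *)

Section ResidualIntersections.
Variable R : comPzRingType.
Hypothesis R_noeth : noetherian R.
Hypothesis R_avoid : avoidance R.
Variables (d : nat) (I : ideal R).
Implicit Types (C D J K L : ideal R) (p q m : Spec R) (xs fs : seq R).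

Definition generated_at p C (n : nat) : Prop := exists fs,
  [/\ (size fs <= n)%N, forall z, z \in fs -> I z & I `<=` sat p (adjoins C fs)].

Lemma generated_at_mono p C C' n n' : C `<=` C' -> (n <= n')%N ->
  generated_at p C n -> generated_at p C' n'.
Proof.
move=> CC' nn' [fs [sz Ifs HI]]; exists fs; split=> //.
  exact: leq_trans nn'.
by apply: subset_trans HI _; apply: sat_mono; exact: adjoins_mono.
Qed.

Lemma generated_at_clear p C n : generated_at p C n -> exists fs s,
  [/\ (size fs <= n)%N, forall z, z \in fs -> I z, ~ p s
    & forall y, I y -> adjoins C fs (s * y)].
Proof.
move=> [fs [sz Ifs HI]]; have [gs Igs] := noetherian_gen R_noeth I.
have [g ggs|s ps Hs] := @sat_finite _ p (adjoins C fs) gs.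
  by apply: HI; rewrite Igs; exact: adjoins_mem.
exists fs, s; split=> // y; rewrite Igs.
suff : adjoins (zero_ideal R) gs `<=` transporter (adjoins C fs) s.
  by move=> H /H /=; rewrite mulrC.
apply: adjoins_min => [_ ->|z zgs]; first exact: ideal_zero.
by rewrite /= mulrC; exact: Hs.
Qed.

(** Steinitz exchange over a local ring: a coefficient of [x] outside [p] lets [x] replace the
    corresponding generator; the other alternative is that all coefficients lie in [p]. *)
Lemma exchange_generator p C fs s x : ~ p s -> adjoins C fs (s * x) ->
  sat p (ideal_sum C (ideal_prod p (adjoins (zero_ideal R) fs))) x \/
  exists f1 g f2, fs = f1 ++ g :: f2 /\ sat p (adjoins (adjoin C x) (f1 ++ f2)) g.
Proof.
elim: fs s x => [|g fs IH] s x ps Hx.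
  left; exists s; split=> //; apply/ideal_sumP; exists (s * x), 0.
  by rewrite addr0; split=> //; exact: ideal_zero.
move: Hx; rewrite [adjoins _ _]adjoinsC => -[c [a [Cc sxE]]].
have [pa|pa] := pselect (p a); last first.
  right; exists [::], g, fs; split=> //=; exists a; split=> //.
  have -> : a * g = s * x - c by rewrite sxE addrC addKr.
  apply: ideal_sub; last by apply: adjoins_mono Cc => //; exact: adjoin_sub.
  by apply: ideal_mul; apply: adjoins_sub; exact: adjoin_mem.
have H1 : adjoins C fs (1 * (s * x - a * g)) by rewrite mul1r sxE addrK.
have [[u [pu Hu]]|[f1 [h [f2 [-> Hh]]]]] :=
    IH 1 (s * x - a * g) (@spec_proper _ p) H1.
  have /ideal_sumP[c' [b [Cc' Hb uE]]] := Hu.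
  left; exists (u * s); split; first exact: spec_mulN.
  apply/ideal_sumP; exists c', (b + u * a * g); split=> //.
    apply: ideal_add.
      apply: ideal_prod_mono Hb => //; rewrite [adjoins _ (g :: _)]adjoinsC.
      exact: adjoin_sub.
    by apply: ideal_prod_mem; [exact: ideal_mul|apply: adjoins_mem; exact: mem_head].
  have -> : u * s * x = u * (s * x - a * g) + u * a * g by ring.
  by rewrite uE addrA.
right; exists (g :: f1), h, f2; split=> //.
apply: sat_mono Hh; apply: adjoins_min => [|z zf]; last first.
  by apply: adjoins_mem; rewrite inE zf orbT.
apply: adjoin_min => [y Cy|]; first by apply: adjoins_sub; exact: adjoin_sub.
apply: ideal_sub; apply: ideal_mul; last by apply: adjoins_mem; exact: mem_head.
by apply: adjoins_sub; exact: adjoin_mem.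
Qed.

(** A general [x] is a minimal generator of [I] modulo [C] at [p], that is, lies outside [L]. By
    Nakayama, [L] contains [I] only if [C] already generates [I] at [p]. *)
Lemma generic_generated_at p C n : generated_at p C n.+1 -> ~ generated_at p C n ->
  generic I (fun x => generated_at p (adjoin C x) n).
Proof.
move=> [fs [sz Ifs HI]] ngen.
pose L := sat p (ideal_sum C (ideal_prod p (adjoins (zero_ideal R) fs))).
apply: (generic_impl (P := fun x => ~ L x)); last first.
  apply: generic_avoid => IL; apply: ngen; exists [::]; split=> //= y /HI.
  suff : sat p (adjoins C fs) `<=` sat p C by apply.
  apply: sat_min; apply: adjoins_min => [z|z zfs]; first exact: sat_sub.
  apply: (nakayama_seq (s := fs)) => // g gfs; apply: IL; exact: Ifs.
move=> x Ix Lx; have [s [ps Hs]] := HI x Ix.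
have [//|[f1 [g [f2 [fsE Hg]]]]] := exchange_generator ps Hs.
exists (f1 ++ f2); split.
- by move: sz; rewrite fsE !size_cat /= addnS.
- move=> z; rewrite mem_cat => zf; apply: Ifs.
  by rewrite fsE mem_cat inE; case/orP: zf => ->; rewrite ?orbT.
apply: subset_trans HI _; apply: sat_min; rewrite fsE.
apply: adjoins_min => [y Cy|z].
  by apply: sat_sub; apply: adjoins_sub; exact: adjoin_sub.
rewrite mem_cat inE orbCA => /orP[/eqP-> //|zf].
by apply: sat_sub; apply: adjoins_mem; rewrite mem_cat.
Qed.

(* [C], generated by [i] general elements of [I], is generically as small as
   possible: [I_p] needs at most [ht p - i] further generators. *)
Definition general_position (i : nat) C : Prop :=
  (forall p n, I `<=` p -> (n < d)%N -> ~ height_geq n.+1 p ->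
    generated_at p C (n - i)) /\
  (forall p, ~ I `<=` p -> C `<=` p -> height_geq i p).

(* The primes of [I] containing this ideal are those where [I / C] is not
   generated by [n] elements. *)
Definition generators_locus C (n : nat) : ideal R :=
  ideal_gen (I `|` [set s | exists fs, [/\ (size fs <= n)%N,
    forall z, z \in fs -> I z & forall y, I y -> adjoins C fs (s * y)]]).

(** Testing the finitely many associated primes of [C] and of the loci suffices. At any other [p]
    where the number of generators has to drop, an associated prime [q] of the locus lies strictly
    below [p]; its smaller height already allows only [t] generators, so [q] cannot contain the
    locus. *)
Lemma generic_general_position i C : C `<=` I -> general_position i C ->
  generic I (fun x => general_position i.+1 (adjoin C x)).
Proof.
move=> CI [Q1 Q2].
have G1 : generic I (fun x => forall p, associated C p -> ~ I `<=` p -> ~ p x).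
  apply: (generic_associated R_noeth) => p _.
  have [Ip|Ip] := pselect (I `<=` p); first exact: generic_true.
  by apply: generic_impl (generic_avoid Ip).
have G2 : generic I (fun x => forall n, (n < d)%N ->
    forall p, associated (generators_locus C n) p ->
    generated_at p C n.+1 -> ~ generated_at p C n -> generated_at p (adjoin C x) n).
  apply: generic_ltn => n _; apply: (generic_associated R_noeth) => p _.
  have [gS|gS] := pselect (generated_at p C n.+1); last exact: generic_true.
  have [gn|gn] := pselect (generated_at p C n); first exact: generic_true.
  by apply: generic_impl (generic_generated_at gS gn).
apply: generic_impl (generic_and G1 G2) => x Ix [{}G1 {}G2].
have CCx : C `<=` adjoin C x by exact: adjoin_sub.
split=> [p n Ip nd hp|p Ip Cp]; last first.
  have px : p x by apply: Cp; exact: adjoin_mem.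
  have [|q [Cq qp Hq]] := @associated_below _ R_noeth C p 1.
    by move=> y; rewrite mulr1 => Cy; apply/Cp/CCx.
  have Iq : ~ I `<=` q by move=> Iq; apply: Ip; exact: subset_trans qp.
  exists q; last by apply: Q2 => //; exact: associated_sub.
  by split=> // pq; apply: (G1 q Cq Iq); exact: pq.
(* Subtraction is truncated: for [n <= i], [C] already generates [I] at [p]. *)
have [ni|] := leqP n i.
  have := Q1 p n Ip nd hp; rewrite (eqP ni) => gen0.
  exact: generated_at_mono CCx (leq0n _) gen0.
move=> ltin; pose t := (n - i.+1)%N.
have nE : n = (i + t).+1 by rewrite -addSn subnKC.
rewrite -/t; have gS : generated_at p C t.+1.
  by have := Q1 p n Ip nd hp; rewrite {1}nE subSn ?leq_addr // addKn.
have [gt|gt] := pselect (generated_at p C t).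
  exact: generated_at_mono CCx (leqnn _) gt.
have Ep : generators_locus C t `<=` p.
  apply: ideal_gen_min => s [/Ip //|[fs [sz Ifs Hs]]].
  apply: contrapT => ps; apply: gt; exists fs; split=> // y Iy.
  by exists s; split=> //; exact: Hs.
have [|q [Eq qp Hq]] := @associated_below _ R_noeth (generators_locus C t) p 1.
  by move=> y; rewrite mulr1; exact: Ep.
have Iq : I `<=` q.
  by move=> y Iy; apply: (associated_sub Eq); apply: ideal_gen_mem; left.
have [pq|pq] := pselect (p `<=` q).
  have epq : q = p by apply: spec_ext; apply/seteqP.
  rewrite epq in Eq; apply: G2 => //; apply: leq_ltn_trans nd.
  by rewrite leq_subr.
have : generated_at q C t.
  have := Q1 q n.-1 Iq; rewrite nE /= addKn; apply.
    by apply: leq_ltn_trans nd; rewrite nE.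
  by move=> hq; apply: hp; exists q => //; rewrite nE.
move=> /generated_at_clear[fs [s [sz Ifs qs Hs]]]; case: qs.
by apply: (associated_sub Eq); apply: ideal_gen_mem; right; exists fs.
Qed.

Lemma general_position_colon i C p : general_position i C -> (i < d)%N ->
  I `<=` p -> colon C I `<=` p -> height_geq i.+1 p.
Proof.
move=> [Q1 _] id Ip Kp; apply: contrapT => hp.
have := Q1 p i Ip id hp; rewrite subnn => /generated_at_clear[fs [s [sz _ ps Hs]]].
by apply/ps/Kp => y Iy; move: sz (Hs y Iy); rewrite leqn0 => /nilP ->.
Qed.

Lemma general_position_height i C p : general_position i C -> (i <= d)%N ->
  colon C I `<=` p -> height_geq i p.
Proof.
move=> GC id Kp; have [Ip|Ip] := pselect (I `<=` p); last first.
  by apply: GC.2 => // x Cx; apply: Kp => y _; exact: ideal_mulr.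
case: i => [|i] // in id GC *; apply: contrapT => hp.
have := GC.1 p i Ip id hp.
have -> : (i - i.+1 = 0)%N by apply/eqP; rewrite subn_eq0.
move=> /generated_at_clear[fs [s [sz _ ps Hs]]].
by apply/ps/Kp => y Iy; move: sz (Hs y Iy); rewrite leqn0 => /nilP ->.
Qed.

Definition residually_unmixed (i : nat) C : Prop :=
  (forall y, I y -> (forall z, I z -> C (y * z)) -> C y) /\
  (forall p, associated (colon C I) p -> ~ height_geq i.+1 p).

Hypothesis R_CM : forall p, cohen_macaulay_at p.
Hypothesis I_height : forall p, I `<=` p -> height_geq 1 p.
Hypothesis I_gen : forall p n, I `<=` p -> (n < d)%N -> ~ height_geq n.+1 p ->
  generated_at p (zero_ideal R) n.
(** The usable form of [S_2]: two strict inclusions above [K] make the local dimension at least 2,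
    hence the depth at least 2. The premise that [I] is not in [C] is the properness demanded of a
    residual intersection. *)
Hypothesis I_S2 : forall xs, (size xs + 2 <= d)%N ->
  (forall z, z \in xs -> I z) ->
  let C := adjoins (zero_ideal R) xs in
  let K := colon C I in
  ~ I `<=` C ->
  (forall p, K `<=` p -> height_geq (size xs) p) ->
  (forall p, I `<=` p -> K `<=` p -> height_geq (size xs).+1 p) ->
  forall p q0 q1 : Spec R, K `<=` q0 -> q0 `<` q1 -> q1 `<` p ->
  exists u v, regular_at p K [:: u; v].

Lemma associated_zero_height p : associated (zero_ideal R) p -> ~ height_geq 1 p.
Proof.
move=> [w pw] hp.
have ass : associated (sat p (adjoins (zero_ideal R) [::])) p.
  exists w => x; rewrite pw; split=> [|[s [ps Hs]]]; first exact: sat_sub.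
  by apply/pw; have /spec_prime[|] : p (s * x) by apply/pw; rewrite -mulrA.
by have := unmixed R_noeth R_avoid (ys := [::]) (R_CM p) Logic.I ass hp.
Qed.

Lemma general_position0 : general_position 0 (zero_ideal R).
Proof. by split=> [p n Ip nd hp|//]; rewrite subn0; exact: I_gen. Qed.

(** By the Cohen-Macaulay property the associated primes of zero have height 0. Hence none contains
    [I], which has positive height. *)
Lemma residually_unmixed0 : residually_unmixed 0 (zero_ideal R).
Proof.
split=> [y Iy HI|p [w pw] hp].
  apply: contrapT => y0; have [p ass Hp] := associated_exists R_noeth y0.
  apply: (associated_zero_height ass); apply: I_height => z Iz; apply: Hp.
  by rewrite mulrC; exact: HI.
have /existsNP[f /not_implyP[If wf]] : ~ colon (zero_ideal R) I w.
  by move=> Hw; apply: (@spec_proper _ p); apply/pw; rewrite mul1r.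
have [q ass Hq] := associated_exists R_noeth wf.
apply: (associated_zero_height ass); apply: height_geq_sub hp => x /pw Hx.
by apply: Hq; rewrite mulrA; exact: Hx.
Qed.

Lemma residually_unmixed_cancel i C x : C `<=` I -> I x ->
  residually_unmixed i C -> nonzerodivisor (colon C I) x ->
  forall y, I y -> C (x * y) -> C y.
Proof.
move=> CI Ix [IK _] Kx y Iy Cxy; apply: IK => //.
by apply: Kx => z _; exact: ideal_mulr.
Qed.

Lemma generic_residual_nzd i C : (i < d)%N -> general_position i C ->
  residually_unmixed i C -> generic I (nonzerodivisor (colon C I)).
Proof.
move=> id GC [_ UC]; apply: (generic_nzd R_noeth) => p Kp Ip; apply: (UC p Kp).
by apply: general_position_colon GC id Ip _; exact: associated_sub.
Qed.

(** Modulo [(K, x)] the depth at [p] is 0, so modulo [K] it is at most 1. By [S_2] no chain of two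
    steps above [K] ends in [p]; thus [p] is adjacent to an associated prime of [K], and
    [height_adjacent] applies. *)
Lemma residual_height xs x p : (size xs + 2 <= d)%N ->
  (forall z, z \in xs -> I z) ->
  let C := adjoins (zero_ideal R) xs in
  ~ I `<=` C -> general_position (size xs) C -> residually_unmixed (size xs) C ->
  nonzerodivisor (colon C I) x ->
  associated (adjoin (colon C I) x) p -> ~ height_geq (size xs).+2 p.
Proof.
move=> id xsI C IC GC [_ UC] Kx ass.
set K := colon C I in Kx ass *.
have lt_id : (size xs < d)%N by apply: leq_trans id; rewrite addn2.
have HS2 := I_S2 id xsI IC (fun q => general_position_height GC (ltnW lt_id))
  (fun q => general_position_colon GC lt_id).
have Kp : K `<=` p by move=> y Ky; apply: (associated_sub ass); exact: adjoin_sub.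
have px : p x by apply: (associated_sub ass); exact: adjoin_mem.
have noclimb q0 q1 : K `<=` q0 -> q0 `<` q1 -> ~ q1 `<` p.
  move=> Kq0 q01 q1p; have [u [v Huv]] := HS2 p q0 q1 Kq0 q01 q1p.
  have Hx : regular_at p K [:: x].
    split=> // a [s [ps Ha]]; exists s; split=> //; apply: Kx.
    by rewrite mulrCA.
  have [w pw] := ass.
  suff : (2 <= 1)%N by [].
  apply: (regular_at_size R_noeth R_avoid (w := w) Hx Huv) => [[s [ps Hs]]|y /pw].
    by apply: ps; apply/pw.
  exact: sat_sub.
have [|q [Kq qp Hq]] := @associated_below _ R_noeth K p 1.
  by move=> y; rewrite mulr1; exact: Kp.
have qx := associated_nzd Kq Kx.
have q_p : q `<` p by split=> // pq; apply/qx/pq.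
have adj (q' : Spec R) : q `<` q' -> ~ q' `<` p.
  by move=> qq'; apply: noclimb qq'; exact: associated_sub.
have q_i n : height_geq n q -> (n <= size xs)%N.
  move=> Hn; rewrite leqNgt; apply/negP => ltn; apply: (UC q Kq).
  exact: height_geq_leq ltn Hn.
by move=> /(height_adjacent R_noeth R_avoid (R_CM p) q_p adj q_i); rewrite ltnn.
Qed.

Lemma residually_unmixedS xs x : (size xs + 2 <= d)%N ->
  (forall z, z \in xs -> I z) -> I x ->
  let C := adjoins (zero_ideal R) xs in
  general_position (size xs) C -> residually_unmixed (size xs) C ->
  nonzerodivisor (colon C I) x -> general_position (size xs).+1 (adjoin C x) ->
  residually_unmixed (size xs).+1 (adjoin C x).
Proof.
move=> id xsI Ix C GC UC Kx GCx.
(* Here [C = I], which residual intersections exclude; [(C, x) : I] is the unit ideal and has no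
   associated primes. *)
have [IC|IC] := pselect (I `<=` C).
  have ICx : I `<=` adjoin C x by move=> y /IC; exact: adjoin_sub.
  split=> [y /ICx //|p [w pw]]; case: (@spec_proper _ p); apply/pw => y /ICx.
  exact: ideal_mul.
have Hp p := residual_height (p := p) id xsI IC GC UC Kx.
have lt_id : ((size xs).+1 < d)%N by apply: leq_trans id; rewrite addn2.
have CI : C `<=` I by apply: adjoins_min => // _ ->; exact: ideal_zero.
have CxK : adjoin C x `<=` adjoin (colon C I) x.
  apply: adjoin_min; last exact: adjoin_mem.
  by move=> y Cy; apply: adjoin_sub => z _; exact: ideal_mulr.
(* Subtracting [a * x] leaves an element of [I] and [K], hence of [C]. So elements of [I] outside
   [(C, x)] stay outside [(K, x)], whose associated primes have bounded height. *)
have EI y : I y -> adjoin (colon C I) x y -> adjoin C x y.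
  move=> Iy [k [a [Kk yE]]]; exists k, a; split=> //; apply: UC.1 => //.
  have -> : k = y - a * x by rewrite yE addrK.
  by apply: ideal_sub => //; exact: ideal_mul.
split=> [y Iy HI|p [w pw] hp].
  apply: contrapT => Cxy; have Ey := contra_not (EI y Iy) Cxy.
  have [p ass pE] := associated_exists R_noeth Ey; apply: (Hp p ass).
  apply: general_position_colon GCx lt_id _ _ => z Hz; apply: pE; apply: CxK.
    by rewrite mulrC; exact: HI.
  exact: Hz.
have /existsNP[f /not_implyP[If wf]] : ~ colon (adjoin C x) I w.
  by move=> Hw; apply: (@spec_proper _ p); apply/pw; rewrite mul1r.
have Ewf := contra_not (EI (w * f) (ideal_mul w If)) wf.
have [q ass qE] := associated_exists R_noeth Ewf; apply: (Hp q ass).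
apply: height_geq_sub hp => z /pw Hz; apply: qE; apply: CxK.
by rewrite mulrA; exact: Hz.
Qed.

(* For [y] in the ideal of [xs] this is the usual d-sequence condition. *)
Definition d_sequence xs : Prop := forall i, (i < size xs)%N -> forall y, I y ->
  adjoins (zero_ideal R) (take i xs) (xs`_i * y) ->
  adjoins (zero_ideal R) (take i xs) y.

Lemma d_sequence_rcons xs x : d_sequence xs ->
  (forall y, I y -> adjoins (zero_ideal R) xs (x * y) -> adjoins (zero_ideal R) xs y) ->
  d_sequence (rcons xs x).
Proof.
move=> Hxs Hx i; rewrite size_rcons ltnS leq_eqVlt => /orP[/eqP->|ltis].
  by rewrite nth_rcons ltnn eqxx -cats1 take_size_cat.
rewrite nth_rcons ltis -cats1 takel_cat ?(ltnW ltis) //; exact: Hxs.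
Qed.

Theorem general_elements : exists xs, [/\ size xs = d,
  forall z, z \in xs -> I z, d_sequence xs &
  forall p, colon (adjoins (zero_ideal R) xs) I `<=` p -> height_geq d p].
Proof.
(* Unmixedness is asked only for [i < d], as the last element is cancelled modulo [K_(d-1)]. Since
   [S_2] for [K_i] yields unmixedness for [K_(i+1)], this accounts for the bound [d - 2]. *)
suff H i : (i <= d)%N -> exists xs, [/\ size xs = i,
    forall z, z \in xs -> I z, d_sequence xs,
    general_position i (adjoins (zero_ideal R) xs) &
    (i < d)%N -> residually_unmixed i (adjoins (zero_ideal R) xs)].
  have [xs [sz Ixs Dxs Gxs _]] := H d (leqnn d).
  by exists xs; split=> // p; apply: general_position_height Gxs _.
elim: i => [|i IH] id.
  exists [::]; split=> // [|_]; first exact: general_position0.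
  exact: residually_unmixed0.
have [xs [sz Ixs Dxs Gxs /(_ id) Uxs]] := IH (ltnW id).
set C := adjoins (zero_ideal R) xs in Gxs Uxs.
have CI : C `<=` I by apply: adjoins_min => // _ ->; exact: ideal_zero.
have [x Ix [Kx GCx]] := generic_ex R_avoid (generic_and
  (generic_residual_nzd id Gxs Uxs) (generic_general_position CI Gxs)).
exists (rcons xs x); split; rewrite ?size_rcons ?sz ?adjoins_rcons //.
- by move=> z; rewrite mem_rcons inE => /orP[/eqP->|/Ixs].
- by apply: d_sequence_rcons => //; exact: residually_unmixed_cancel Uxs Kx.
by move=> ltid; rewrite -sz; apply: residually_unmixedS; rewrite ?sz ?addn2.
Qed.

End ResidualIntersections.

(** * Ideals of linear type and their reductions *)

Section LinearType.
Variable R : comPzRingType.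
Implicit Types (A B P : R -> R -> Prop) (y c u v : R).

(* Pairs [(F x, F v)] of values of forms [F] of degree [t] are what remains of
   the symmetric algebra once a single evaluation of it is fixed. *)
Definition pair_module A : Prop :=
  [/\ A 0 0, forall y c y' c', A y c -> A y' c' -> A (y + y') (c + c')
    & forall a y c, A y c -> A (a * y) (a * c)].

Inductive pair_prod A B : R -> R -> Prop :=
| PairMul u v y c : A u v -> B y c -> pair_prod A B (u * y) (v * c)
| PairAdd y c y' c' : pair_prod A B y c -> pair_prod A B y' c' ->
    pair_prod A B (y + y') (c + c').

(** A form of degree 0 is a constant and has the same value under both evaluations. *)
Fixpoint pair_pow P (t : nat) : R -> R -> Prop :=
  if t is t'.+1 then pair_prod P (pair_pow P t') else fun y c => y = c.

Lemma pair_prod_module A B : pair_module A -> pair_module B ->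
  pair_module (pair_prod A B).
Proof.
move=> [A0 _ AM] [B0 _ _]; split=> [|y c y' c'|a y c].
- by rewrite -[0](mulr0 0); exact: PairMul.
- exact: PairAdd.
elim=> {y c} [u v y c Auv Byc|y c y' c' _ IH _ IH']; last first.
  by rewrite !mulrDr; exact: PairAdd.
by rewrite !mulrA; apply: PairMul => //; exact: AM.
Qed.

Lemma pair_pow_module P t : pair_module P -> pair_module (pair_pow P t).
Proof.
move=> modP; elim: t => [|t IH]; last exact: pair_prod_module.
by split=> //= [y c y' c' -> ->|a y c ->].
Qed.

Lemma pair_pow1 P y c : pair_module P -> pair_pow P 1 y c -> P y c.
Proof.
move=> [_ PD PM]; elim=> {y c} [u v y c Puv <-|y c y' c' _ IH _ IH'].
  by rewrite ![_ * y]mulrC; exact: PM.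
exact: PD.
Qed.

Lemma pair_prodCA A P B u v y c : P u v -> pair_prod A B y c ->
  pair_prod A (pair_prod P B) (u * y) (v * c).
Proof.
move=> Puv; elim=> {y c} [u' v' y c Auv Byc|y c y' c' _ IH _ IH']; last first.
  by rewrite !mulrDr; exact: PairAdd.
by rewrite mulrCA [v * _]mulrCA; apply: PairMul => //; exact: PairMul.
Qed.

Lemma pair_prod_fst A B (J : ideal R) y c : (forall u v, A u v -> J u) ->
  pair_prod A B y c -> J y.
Proof.
move=> AJ; elim=> {y c} [u v y c /AJ Ju _|y c y' c' _ IH _ IH'].
  exact: ideal_mulr.
exact: ideal_add.
Qed.

Lemma pair_prod_snd A B (J : ideal R) y c : (forall u v, A u v -> J v) ->
  pair_prod A B y c -> J c.
Proof.
move=> AJ; elim=> {y c} [u v y c /AJ Jv _|y c y' c' _ IH _ IH'].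
  exact: ideal_mulr.
exact: ideal_add.
Qed.

Variables (I : ideal R) (xs : seq R).
Hypothesis xsI : forall z, z \in xs -> I z.
Hypothesis xs_dseq : d_sequence I xs.

Let a_ (i : nat) : ideal R := adjoins (zero_ideal R) (take i xs).
Let a : ideal R := adjoins (zero_ideal R) xs.

Let a_S i : (i < size xs)%N -> a_ i.+1 = adjoin (a_ i) xs`_i.
Proof. by move=> lt_i; rewrite /a_ (take_nth 0) // adjoins_rcons. Qed.

Let a_sub i : a_ i `<=` a.
Proof. by apply: adjoins_mono => // z /mem_take. Qed.

Let aI : a `<=` I.
Proof. by apply: adjoins_min => // _ ->; exact: ideal_zero. Qed.

Section Forms.
Variable P : R -> R -> Prop.
Hypothesis P_mod : pair_module P.
Hypothesis P_fst : forall y c, P y c -> a y.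
Hypothesis P_lift : forall i, (i < size xs)%N -> exists c, P xs`_i c.

Let P_ i y c := P y c /\ a_ i y.

Let split_pair i ci B y c : (i < size xs)%N -> P xs`_i ci -> pair_module B ->
  pair_prod (P_ i.+1) B y c -> exists y1 c1 y2 c2,
  [/\ pair_prod (P_ i) B y1 c1, B y2 c2, y = y1 + xs`_i * y2 & c = c1 + ci * c2].
Proof.
move=> lt_i Pi [B0 BD BM]; have [P0 PD PM] := P_mod.
elim=> {y c} [u v y c [Puv]|y c y' c' _ [y1 [c1 [y2 [c2 [H1 H2 -> ->]]]]]].
  rewrite a_S // => -[u' [r [au' uE]]] Byc.
  exists ((u - r * xs`_i) * y), ((v - r * ci) * c), (r * y), (r * c); split.
  - apply: PairMul => //; split; last by rewrite uE addrK.
    by rewrite -!mulNr; apply: PD => //; exact: PM.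
  - exact: BM.
  - by ring.
  - by ring.
move=> _ [y1' [c1' [y2' [c2' [H1' H2' -> ->]]]]].
exists (y1 + y1'), (c1 + c1'), (y2 + y2'), (c2 + c2').
split; [exact: PairAdd|exact: BD|ring|ring].
Qed.

(* Forms whose value lies in [a_ i] are combinations of linear forms with value
   in [a_ i]: by descending induction on [i] and induction on the degree. *)
Lemma form_decompose t i y c : (i <= size xs)%N -> pair_pow P t.+1 y c ->
  a_ i y -> pair_prod (P_ i) (pair_pow P t) y c.
Proof.
elim: t i y c => [|t IHt] i y c le_i Pyc ay.
  rewrite -[y]mulr1 -[c]mulr1; apply: PairMul => //; split=> //.
  exact: pair_pow1.
rewrite -(subKn le_i) in ay *; elim: (size xs - i)%N (leq_subr i (size xs)) y c Pyc ay.
  rewrite subn0 => _ y' c'; elim=> {y' c'} [u v y' c' Puv Pyc _|y1 c1 y2 c2 H1 IH1 H2 IH2 _].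
    by apply: PairMul => //; split=> //; rewrite /a_ take_size; exact: P_fst Puv.
  have Pa u v : P u v -> a u by exact: P_fst.
  by apply: PairAdd; [apply: IH1|apply: IH2]; rewrite /a_ take_size;
    [exact: pair_prod_fst Pa H1|exact: pair_prod_fst Pa H2].
move=> k IHk lt_k y' c' Pyc ay'; set j := (size xs - k.+1)%N in ay' *.
have lt_j : (j < size xs)%N by rewrite /j ltn_subrL (leq_trans _ lt_k).
have jE : (size xs - k = j.+1)%N by rewrite /j subnSK.
have [cj Pj] := P_lift lt_j.
have := IHk (ltnW lt_k) _ _ Pyc; rewrite jE => /(_ _)/(split_pair lt_j Pj).
have ay1 : a_ j.+1 y' by rewrite a_S //; exact: adjoin_sub.
move=> /(_ (pair_pow_module _ P_mod) ay1) [y1 [c1 [y2 [c2 [H1 H2 yE cE]]]]].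
have a1 : a_ j y1 by apply: pair_prod_fst H1 => u v [].
have a2 : a_ j y2.
  apply: xs_dseq => //.
    by apply: aI; apply: pair_prod_fst H2; exact: P_fst.
  by apply: (ideal_addlr a1); rewrite -yE.
rewrite yE cE; apply: PairAdd => //; apply: pair_prodCA => //.
by apply: IHt => //; exact: ltnW.
Qed.

(** This is linear type: as [a_ 0] is zero, a form with first value zero is a combination of linear
    forms with first value zero. *)
Lemma form_vanish (b : ideal R) t c : (forall v, P 0 v -> b v) ->
  pair_pow P t.+1 0 c -> b c.
Proof.
move=> Pb Pc; have := @form_decompose t 0 0 c (leq0n _) Pc (ideal_zero _).
apply: pair_prod_snd => u v [Puv]; rewrite /a_ take0 => u0.
by apply: Pb; rewrite -[X in P X]u0.
Qed.

Lemma form_lift1 y : a y -> exists c, P y c.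
Proof.
have [P0 PD PM] := P_mod.
unshelve epose (L := Ideal (ideal_set := [set y | exists c, P y c]) _ _ _).
- by exists 0.
- by move=> u v [c Pu] [c' Pv]; exists (c + c'); exact: PD.
- by move=> r u [c Pu]; exists (r * c); exact: PM.
suff : a `<=` L by apply.
apply: adjoins_min => [_ ->|z /(nthP 0)[i lt_i <-]]; first by exists 0.
exact: P_lift.
Qed.

Lemma form_lift t y : ideal_exp a t y -> exists c, pair_pow P t y c.
Proof.
elim: t y => [|t IH] y; first by move=> _; exists y.
have [P0 PD PM] := pair_pow_module t.+1 P_mod.
unshelve epose (L := Ideal (ideal_set := [set y | exists c, pair_pow P t.+1 y c]) _ _ _).
- by exists 0.
- by move=> u v [c Pu] [c' Pv]; exists (c + c'); exact: PD.
- by move=> r u [c Pu]; exists (r * c); exact: PM.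
suff : ideal_exp a t.+1 `<=` L by apply.
apply: ideal_prod_min => u v /form_lift1[c Pu] /IH[c' Pv].
by exists (c * c'); exact: PairMul.
Qed.

Lemma form_lift_prod (J b : ideal R) t y : J `<=` a ->
  (forall u v, J u -> P u v -> b v) -> ideal_prod J (ideal_exp a t) y ->
  exists2 c, pair_pow P t.+1 y c & b c.
Proof.
move=> Ja Jb; have [P0 PD PM] := pair_pow_module t.+1 P_mod.
unshelve epose (L := Ideal
  (ideal_set := [set y | exists2 c, pair_pow P t.+1 y c & b c]) _ _ _).
- by exists 0 => //; exact: ideal_zero.
- by move=> u v [c Pu bc] [c' Pv bc']; exists (c + c'); [exact: PD|exact: ideal_add].
- by move=> r u [c Pu bc]; exists (r * c); [exact: PM|exact: ideal_mul].
suff : ideal_prod J (ideal_exp a t) `<=` L by apply.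
apply: ideal_prod_min => u v Ju /form_lift[c' Pv].
have [c Pu] := form_lift1 (Ja _ Ju); exists (c * c'); first exact: PairMul.
by apply: ideal_mulr; exact: Jb Pu.
Qed.

Lemma form_expX t u v : P u v -> pair_pow P t (u ^+ t) (v ^+ t).
Proof.
by move=> Puv; elim: t => [|t IH] //; rewrite !exprS; exact: PairMul.
Qed.

End Forms.

(** With [S = J + a_ i] and [b = S : xs]_i[, dividing]e * y[by]xs[_i] modulo [S] is a linear map
    from [a] to [R / b] that kills [J] and sends [xs]_i[to]e[. By linear type it extends to forms,
    and]delta * xs[_i ^+ t.+1] in [J a^t] forces [delta * e ^+ t.+1] into [b]. *)
Lemma reduction_descend (J : ideal R) t delta e i : J `<=` a ->
  (forall y, a y -> ideal_prod J (ideal_exp a t) (delta * y ^+ t.+1)) ->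
  (i < size xs)%N ->
  (forall y, a y -> ideal_sum J (a_ i.+1) (e * y)) ->
  forall y, a y -> ideal_sum J (a_ i) (delta * e ^+ t.+1 * e * y).
Proof.
move=> Ja HJ lt_i He; set S := ideal_sum J (a_ i).
have JS : J `<=` S.
  by move=> u Ju; apply/ideal_sumP; exists u, 0; rewrite addr0; split=> //; exact: ideal_zero.
have e_lift y : a y -> exists c, S (e * y - c * xs`_i).
  move=> /He/ideal_sumP[u [v [Ju]]]; rewrite a_S // => -[v' [c [av' ->]]] ->.
  exists c; apply/ideal_sumP; exists u, v'; split=> //; ring.
have xi_a : a xs`_i by apply: adjoins_mem; exact: mem_nth.
pose P y c := a y /\ S (e * y - c * xs`_i).
have P_mod : pair_module P.
  split.
  - by rewrite /P mulr0 mul0r subr0; split; exact: ideal_zero.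
  - move=> y c y' c' [ay Sy] [ay' Sy']; split; first exact: ideal_add.
    have -> : e * (y + y') - (c + c') * xs`_i =
      (e * y - c * xs`_i) + (e * y' - c' * xs`_i) by ring.
    exact: ideal_add.
  - move=> r y c [ay Sy]; split; first exact: ideal_mul.
    have -> : e * (r * y) - r * c * xs`_i = r * (e * y - c * xs`_i) by ring.
    exact: ideal_mul.
have P_fst y c : P y c -> a y by case.
have P_lift j : (j < size xs)%N -> exists c, P xs`_j c.
  move=> lt_j; have aj : a xs`_j by apply: adjoins_mem; exact: mem_nth.
  by have [c Hc] := e_lift _ aj; exists c.
pose b := transporter S xs`_i.
have Jb u v : J u -> P u v -> b v.
  move=> Ju [_ Suv]; have Se : S (e * u) by apply: JS; exact: ideal_mul.
  have := ideal_sub Se Suv.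
  by have -> : e * u - (e * u - v * xs`_i) = v * xs`_i by ring.
have Pi : P xs`_i e by split=> //; rewrite subrr; exact: ideal_zero.
have [c Pc bc] := form_lift_prod P_mod P_lift Ja Jb (HJ _ xi_a).
have [_ QD QM] := pair_pow_module t.+1 P_mod.
have bd : b (delta * e ^+ t.+1).
  have H0 : pair_pow P t.+1 0 (delta * e ^+ t.+1 - c).
    rewrite -(subrr (delta * xs`_i ^+ t.+1)); apply: QD.
      by apply: QM; exact: form_expX.
    rewrite -[- c]mulN1r -[X in pair_pow _ _ X]mulN1r; exact: QM.
  rewrite -[X in b X](subrK c); apply: ideal_add => //.
  apply: (form_vanish P_mod P_fst P_lift _ H0) => v; apply: Jb.
  exact: ideal_zero.
move=> y /e_lift[c' Hc']; have Sd : S (delta * e ^+ t.+1 * xs`_i) by [].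
have -> : delta * e ^+ t.+1 * e * y = delta * e ^+ t.+1 * (e * y - c' * xs`_i) +
  c' * (delta * e ^+ t.+1 * xs`_i) by ring.
by apply: ideal_add; exact: ideal_mul.
Qed.

(** One descent replaces [e] by [delta * e ^+ t.+2], starting from [e = 1]. *)
Fixpoint reduction_exponent (t n : nat) : nat :=
  if n is n'.+1 then (1 + t.+2 * reduction_exponent t n')%N else 0%N.

Lemma reduction_power (J : ideal R) t delta : J `<=` a ->
  (forall y, a y -> ideal_prod J (ideal_exp a t) (delta * y ^+ t.+1)) ->
  forall y, a y -> J (delta ^+ reduction_exponent t (size xs) * y).
Proof.
move=> Ja HJ; suff H k : (k <= size xs)%N -> forall y, a y ->
    ideal_sum J (a_ (size xs - k)) (delta ^+ reduction_exponent t k * y).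
  move=> y /(H _ (leqnn _)); rewrite subnn /a_ take0 => /ideal_sumP[u [_ [Ju -> ->]]].
  by rewrite addr0.
elim: k => [|k IH] lt_k y ay.
  rewrite subn0 /a_ take_size expr0 mul1r; apply/ideal_sumP; exists 0, y.
  by rewrite add0r; split=> //; exact: ideal_zero.
have lt_j : (size xs - k.+1 < size xs)%N by rewrite ltn_subrL (leq_trans _ lt_k).
have {}IH := IH (ltnW lt_k); rewrite -subnSK // in IH.
have := reduction_descend Ja HJ lt_j IH ay.
suff -> : delta ^+ reduction_exponent t k.+1 * y = delta *
  (delta ^+ reduction_exponent t k) ^+ t.+1 * delta ^+ reduction_exponent t k * y by [].
by rewrite -(mulrA delta) -exprSr -exprM mulnC -exprS.
Qed.

(* The exponent depends on [r] but not on the reduction [J]. *)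
Theorem reduction_bound (J : ideal R) r s gamma : J `<=` I ->
  (forall y, I y -> a (gamma * y)) ->
  (forall y, ideal_exp I r.+1 y -> ideal_prod J (ideal_exp I r) (s * y)) ->
  forall y, I y ->
  J ((gamma ^+ r.+1 * s) ^+ reduction_exponent r (size xs) * gamma * y).
Proof.
move=> JI gI HJ y Iy.
(* [J] need not lie in [a], but [gamma J] does. Carrying the [r.+1] factors of [J I^r] into [a]
   costs [gamma ^+ r.+1], whence [delta = gamma ^+ r.+1 * s]. *)
pose gJ := ideal_prod (adjoin (zero_ideal R) gamma) J.
have gJa : gJ `<=` a.
  apply: ideal_prod_min => _ u [_ [c [-> ->]]] Ju; rewrite add0r -mulrA.
  by apply: ideal_mul; apply: gI; exact: JI.
have gexp n z : ideal_exp I n z -> ideal_exp a n (gamma ^+ n * z).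
  elim: n z => [|n IH] z; first by move=> _; exact: full_idealP.
  rewrite mulrC; move: z; apply: ideal_prod_transporter => u v Iu Iv.
  have -> : u * v * gamma ^+ n.+1 = (gamma * u) * (gamma ^+ n * v) by rewrite exprS; ring.
  by apply: ideal_prod_mem; [exact: gI|exact: IH].
rewrite -mulrA; apply: (ideal_prod_subr (I := adjoin (zero_ideal R) gamma)).
apply: reduction_power gJa _ _ (gI y Iy) => z az.
have := HJ _ (ideal_expX r.+1 (aI az)); rewrite -mulrA.
move: (s * z ^+ r.+1) => x; rewrite mulrC; move: x.
apply: ideal_prod_transporter => u v Ju Iv.
have -> : u * v * gamma ^+ r.+1 = (gamma * u) * (gamma ^+ r * v) by rewrite exprS; ring.
apply: ideal_prod_mem; last exact: gexp.
by apply: ideal_prod_mem => //; exact: adjoin_mem.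
Qed.

End LinearType.

(** * Uniform reduction numbers *)

Section HilbertBasis.
Variable R : comNzRingType.
Hypothesis R_noeth : noetherian R.
Implicit Types (J : ideal {poly R}) (G : seq {poly R}).

Definition leading_ideal J (n : nat) : ideal R.
Proof.
exists [set a | exists f : {poly R}, [/\ J f, (size f <= n.+1)%N & f`_n = a]].
- by exists 0; rewrite coef0 size_poly0; split=> //; exact: ideal_zero.
- move=> _ _ [f [Jf szf <-]] [g [Jg szg <-]]; exists (f + g); rewrite coefD.
  split=> //; first exact: ideal_add.
  by rewrite (leq_trans (size_polyD _ _)) // geq_max szf.
- move=> a _ [f [Jf szf <-]]; exists (a%:P * f); rewrite coefCM.
  split=> //; first exact: ideal_mul.
  by rewrite mul_polyC (leq_trans (size_scale_leq _ _)).
Defined.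

Lemma leading_ideal_incr J n : leading_ideal J n `<=` leading_ideal J n.+1.
Proof.
move=> _ [f [Jf szf <-]]; exists ('X * f); rewrite coefXM /=.
split=> //; first exact: ideal_mul.
have [->|f0] := eqVneq f 0; first by rewrite mulr0 size_poly0.
by rewrite mulrC size_mulX.
Qed.

Lemma leading_ideal_gen J n : exists G, (forall f, f \in G -> J f) /\
  leading_ideal J n `<=` leading_ideal (adjoins (zero_ideal {poly R}) G) n.
Proof.
have [s sE] := noetherian_gen R_noeth (leading_ideal J n).
have : forall a, a \in s -> leading_ideal J n a.
  by move=> a ais; rewrite sE; exact: adjoins_mem.
suff H : (forall a, a \in s -> leading_ideal J n a) ->
    exists G, (forall f, f \in G -> J f) /\
    adjoins (zero_ideal R) s `<=` leading_ideal (adjoins (zero_ideal {poly R}) G) n.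
  by move=> /H[G [GJ HG]]; exists G; split=> //; rewrite sE.
elim: {sE}s => [|a s IH] Hs.
  by exists [::]; split=> // _ ->; exact: ideal_zero.
have [G [GJ HG]] := IH (fun b bs => Hs b (mem_behead (s := a :: s) bs)).
have [f [Jf szf fa]] := Hs a (mem_head _ _); exists (f :: G); split.
  by move=> g; rewrite inE => /orP[/eqP->|/GJ].
rewrite [adjoins _ (a :: s)]adjoinsC; apply: adjoin_min => [b /HG[g [Hg szg gb]]|].
  exists g; split=> //; rewrite [adjoins _ (f :: G)]adjoinsC; exact: adjoin_sub.
by exists f; split=> //; apply: adjoins_mem; exact: mem_head.
Qed.

Theorem hilbert_basis : noetherian {poly R}.
Proof.
move=> J; have [N HN] := noetherian_chain R_noeth (@leading_ideal_incr J).
have [G [GJ HG]] : exists G, (forall f, f \in G -> J f) /\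
    forall n, (n <= N)%N ->
      leading_ideal J n `<=` leading_ideal (adjoins (zero_ideal {poly R}) G) n.
  elim: {HN}N => [|N [G [GJ HG]]].
    have [G [GJ HG]] := leading_ideal_gen J 0; exists G; split=> // n.
    by rewrite leqn0 => /eqP->.
  have [G' [GJ' HG']] := leading_ideal_gen J N.+1; exists (G ++ G'); split.
    by move=> f; rewrite mem_cat => /orP[/GJ|/GJ'].
  move=> n; rewrite leq_eqVlt ltnS => /orP[/eqP->|nN] a.
    move=> /HG'[f [Hf szf fa]]; exists f; split=> //.
    by apply: adjoins_mono Hf => // g gG; rewrite mem_cat gG orbT.
  move=> /(HG n nN)[f [Hf szf fa]]; exists f; split=> //.
  by apply: adjoins_mono Hf => // g gG; rewrite mem_cat gG.
exists (size G), (in_tuple G); suff -> : J = ideal_gen [set` G] by []; rewrite ideal_gen_seq.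
apply: ideal_eqP; last by apply: adjoins_min => // _ ->; exact: ideal_zero.
have H k : forall f : {poly R}, (size f <= k)%N -> J f -> adjoins (zero_ideal {poly R}) G f.
  elim: k => [|n IH] f.
    by rewrite size_poly_leq0 => /eqP-> _; exact: ideal_zero.
  move=> szf Jf; suff [g [Gg szg gf]] :
      leading_ideal (adjoins (zero_ideal {poly R}) G) n f`_n.
    rewrite -(subrK g f); apply: ideal_add => //; apply: IH.
      apply/leq_sizeP => j; rewrite coefB leq_eqVlt => /orP[/eqP<-|ltj].
        by rewrite gf subrr.
      by rewrite !nth_default ?subrr // (leq_trans _ ltj).
    apply: ideal_sub => //; move: Gg; suff : adjoins (zero_ideal {poly R}) G `<=` J by apply.
    by apply: adjoins_min => // _ ->; exact: ideal_zero.
  have Lf : leading_ideal J n f`_n by exists f.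
  (* In degrees above [N], generators of degree [N] are shifted by powers of ['X]. *)
  have [nN|Nn] := leqP n N; first exact: HG.
  have := HG N (leqnn N) _ (HN n _ Lf); move: (f`_n) => a.
  rewrite -(subnK (ltnW Nn)); elim: (n - N)%N => [|k IHk] // /IHk.
  by rewrite addSn => /leading_ideal_incr.
by move=> f; exact: H.
Qed.

End HilbertBasis.

(** An iterated polynomial ring, known only through its evaluations at points of [R]. *)
Lemma polynomial_parameters (R : comNzRingType) (n : nat) : noetherian R ->
  exists (S : comNzRingType) (iota : {rmorphism R -> S}) (X : nat -> S),
  noetherian S /\ forall A : nat -> R, exists ev : {rmorphism S -> R},
    (forall a, ev (iota a) = a) /\ forall i, (i < n)%N -> ev (X i) = A i.
Proof.
move=> R_noeth; elim: n => [|n [S [iota [X [S_noeth HS]]]]].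
  by exists R, idfun, (fun=> 0); split=> // A; exists idfun.
exists {poly S}, (polyC \o iota), (fun i => if i == n then 'X else (X i)%:P).
split=> [|A]; first exact: hilbert_basis.
have [ev [ev_iota evX]] := HS A.
exists (ev \o horner_eval (iota (A n))); split=> [a|i] /=.
  by rewrite /horner_eval hornerC.
rewrite /horner_eval ltnS leq_eqVlt; case: eqVneq => [->|_] /=.
  by rewrite hornerX ev_iota.
by rewrite hornerC => /evX.
Qed.

(** * Reductions modulo a maximal ideal *)

Section UniformReductionNumber.
Variable R : comNzRingType.
Hypothesis R_noeth : noetherian R.
Variables (m : Spec R) (I : ideal R).
Hypothesis m_max : maximal m.
Implicit Types (J M : ideal R).

Lemma maximal_inverse c : ~ m c -> exists c', m (1 - c' * c).
Proof.
move=> mc; have : adjoin m c 1.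
  apply: contrapT => H1; apply/mc/(m_max (@adjoin_sub _ m c) H1); exact: adjoin_mem.
by move=> [a [c' [ma ->]]]; exists c'; rewrite addrK.
Qed.

Definition ideal_meet J M : ideal R.
Proof.
exists [set x | J x /\ M x].
- by split; exact: ideal_zero.
- by move=> x y [? ?] [? ?]; split; exact: ideal_add.
- by move=> a x [? ?]; split; exact: ideal_mul.
Defined.

(* Subspaces of an [n]-dimensional space over [R / m] are spanned by at most
   [n] vectors. *)
Lemma few_generators M fs J : (forall c f, m c -> f \in fs -> M (c * f)) ->
  J `<=` adjoins M fs -> exists ys, [/\ (size ys <= size fs)%N,
    forall y, y \in ys -> J y & J `<=` adjoins M ys].
Proof.
elim: fs J => [|g fs IH] J HM HJ; first by exists [::].
have HM' c f : m c -> f \in fs -> M (c * f).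
  by move=> mc ffs; apply: HM => //; rewrite inE ffs orbT.
have [Jfs|] := pselect (J `<=` adjoins M fs).
  have [ys [sz ysJ HJys]] := IH J HM' Jfs; exists ys; split=> //.
  exact: leqW.
move=> /existsNP[u /not_implyP[Ju fsu]].
rewrite [adjoins _ (g :: fs)]adjoinsC in HJ.
have [v [c [fsv uE]]] := HJ u Ju.
have Mg b : m b -> adjoins M fs (b * g).
  by move=> mb; apply: adjoins_sub; apply: HM => //; exact: mem_head.
have mc : ~ m c by move=> /Mg fscg; apply: fsu; rewrite uE; exact: ideal_add.
have [c' mc'] := maximal_inverse mc.
(* [c] is invertible modulo [m], so subtracting a multiple of [u] removes [g] from any element of
   [J]. *)
have [|ys [sz ysJ HJys]] := IH (ideal_meet J (adjoins M fs)) HM'; first by move=> x [].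
exists (u :: ys); split=> // [y|x Jx].
  by rewrite inE => /orP[/eqP->|/ysJ[]].
rewrite [adjoins _ (u :: ys)]adjoinsC.
have [v' [e [fsv' xE]]] := HJ x Jx.
exists (x - e * c' * u), (e * c'); rewrite subrK; split=> //; apply: HJys; split.
  by apply: ideal_sub => //; exact: ideal_mul.
have -> : x - e * c' * u = v' - e * c' * v + e * ((1 - c' * c) * g).
  by rewrite xE uE; ring.
apply: ideal_add; last by apply: ideal_mul; exact: Mg.
by apply: ideal_sub => //; exact: ideal_mul.
Qed.

(** By Nakayama, containing [I^(r+1)] means reduction number at most [r] at [m]; modulo [m I^(r+1)]
    only the image of [J] in [I / m I] matters, a subspace of a finite-dimensional space. *)
Definition reduction_step J (r : nat) : ideal R :=
  ideal_sum (ideal_prod J (ideal_exp I r)) (ideal_prod m (ideal_exp I r.+1)).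

Definition ideal_preimage (S T : comPzRingType) (f : {rmorphism S -> T})
  (J : ideal T) : ideal S.
Proof.
exists [set x | J (f x)].
- by rewrite /= rmorph0; exact: ideal_zero.
- by move=> x y /= Jx Jy; rewrite rmorphD; exact: ideal_add.
- by move=> a x /= Jx; rewrite rmorphM; exact: ideal_mul.
Defined.

Lemma reduction_step_mono J J' r : (forall y, J y -> J' y \/ ideal_prod m I y) ->
  reduction_step J r `<=` reduction_step J' r.
Proof.
move=> JJ'; apply: ideal_gen_min => x [|]; last exact: ideal_sum_subr.
move: x; apply: ideal_prod_min => y h /JJ'[J'y|mIy] Ih.
  by apply: ideal_sum_subl; exact: ideal_prod_mem.
apply: ideal_sum_subr; move: y mIy; apply: ideal_prod_transporter => u v mu Iv.
by rewrite -mulrA; apply: ideal_prod_mem => //; exact: ideal_prod_mem.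
Qed.

Lemma reduction_step_seq J ys r : (forall y, y \in ys -> J y) ->
  J `<=` adjoins (ideal_prod m I) ys ->
  reduction_step J r `<=` reduction_step (adjoins (zero_ideal R) ys) r.
Proof.
move=> ysJ HJ; apply: ideal_gen_min => x [|]; last exact: ideal_sum_subr.
move: x; apply: ideal_prod_min => y h Jy Ih.
suff : adjoins (ideal_prod m I) ys `<=`
    transporter (reduction_step (adjoins (zero_ideal R) ys) r) h.
  by apply; exact: HJ.
apply: adjoins_min => [z mIz|z zys]; last first.
  by apply: ideal_sum_subl; apply: ideal_prod_mem => //; exact: adjoins_mem.
apply: ideal_sum_subr; move: z mIz; apply: ideal_prod_transporter => u v mu Iv.
by rewrite -mulrA; apply: ideal_prod_mem => //; exact: ideal_prod_mem.
Qed.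

Lemma adjoins_coef fs y : adjoins (zero_ideal R) fs y ->
  exists A : nat -> R, y = \sum_(j < size fs) A j * fs`_j.
Proof.
elim: fs y => [|g fs IH] y; first by move=> ->; exists (fun=> 0); rewrite big_ord0.
rewrite [adjoins _ (g :: fs)]adjoinsC => -[v [c [/IH[A ->] ->]]].
exists (fun j => if j is j'.+1 then A j' else c).
by rewrite big_ord_recl /= addrC.
Qed.

Lemma ideal_sum_ord (S : comPzRingType) (J : ideal S) n (F : 'I_n -> S) :
  (forall i, J (F i)) -> J (\sum_(i < n) F i).
Proof.
by move=> JF; elim/big_ind: _ => [|x y|i _]; [exact: ideal_zero|exact: ideal_add|].
Qed.

(* The reductions of [I] modulo [m] are parametrized by square matrices, and
   those of reduction number at most [r] form open sets increasing with [r];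
   the chain of the ideals of their complements stabilizes. *)
Lemma uniform_reduction_number : exists r0, forall J r, J `<=` I ->
  ideal_exp I r.+1 `<=` reduction_step J r ->
  ideal_exp I r0.+1 `<=` reduction_step J r0.
Proof.
have [fs Ifs] := noetherian_gen R_noeth I; pose n := size fs.
have fsI z : z \in fs -> I z by move=> zfs; rewrite Ifs; exact: adjoins_mem.
have [S [iota [X [S_noeth HS]]]] := polynomial_parameters (n * n) R_noeth.
(* [Y i] is row [i] of a matrix of unknowns applied to [fs], and [T r] is the [reduction_step] of
   the ideal they generate. Where some element of [Q r] does not vanish, the specialized ideal has
   reduction number at most [r] modulo [m]. *)
pose Y (i : nat) := \sum_(j < n) X (i * n + j)%N * iota fs`_j.
pose T r := ideal_gen
  ([set s | exists i h, [/\ (i < n)%N, ideal_exp I r h & s = Y i * iota h]] `|`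
   [set s | exists2 z, ideal_prod m (ideal_exp I r.+1) z & s = iota z]).
have TY r i h : (i < n)%N -> ideal_exp I r h -> T r (Y i * iota h).
  by move=> lt_i Ih; apply: ideal_gen_mem; left; exists i, h.
have Tm r z : ideal_prod m (ideal_exp I r.+1) z -> T r (iota z).
  by move=> Hz; apply: ideal_gen_mem; right; exists z.
pose Q r := colon (T r) (ideal_gen (iota @` ideal_exp I r.+1)).
have QP r s : (forall g, ideal_exp I r.+1 g -> T r (s * iota g)) -> Q r s.
  move=> Hs x Gx; rewrite mulrC; move: x Gx.
  suff : ideal_gen (iota @` ideal_exp I r.+1) `<=` transporter (T r) s by apply.
  by apply: ideal_gen_min => _ [g Ig <-] /=; rewrite mulrC; exact: Hs.
have TS r s u : T r s -> I u -> T r.+1 (s * iota u).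
  move=> Ts Iu; suff : T r `<=` transporter (T r.+1) (iota u) by apply.
  apply: ideal_gen_min => {Ts}s [[i [h [lt_i Ih ->]]]|[z mz ->]].
    suff : T r.+1 (Y i * iota h * iota u) by [].
    rewrite -mulrA -rmorphM [h * u]mulrC.
    by apply: TY => //; exact: ideal_prod_mem.
  suff : T r.+1 (iota z * iota u) by [].
  rewrite -rmorphM; apply: Tm; move: z mz.
  apply: ideal_prod_transporter => a b ma Ib; rewrite -mulrA [b * u]mulrC.
  by apply: ideal_prod_mem => //; exact: ideal_prod_mem.
have Q_incr r : Q r `<=` Q r.+1.
  move=> s Qs; apply: QP => g; rewrite mulrC; move: g.
  suff : ideal_exp I r.+2 `<=` ideal_preimage iota (transporter (T r.+1) s) by apply.
  apply: ideal_prod_min => u v Iu Iv; suff : T r.+1 (iota (u * v) * s) by [].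
  have -> : iota (u * v) * s = s * iota v * iota u by rewrite rmorphM; ring.
  apply: TS => //; apply: Qs.
  by apply: ideal_gen_mem; exists v.
have [r0 Hr0] := noetherian_chain S_noeth Q_incr.
exists r0 => J r JI HJ.
have [c f mc ffs||ys [sz ysJ HJys]] := @few_generators (ideal_prod m I) fs J.
- by apply: ideal_prod_mem => //; exact: fsI.
- by move=> y /JI; rewrite {1}Ifs; apply: adjoins_mono => // _ ->; exact: ideal_zero.
have {}HJ : ideal_exp I r.+1 `<=` reduction_step (adjoins (zero_ideal R) ys) r.
  exact: subset_trans (reduction_step_seq ysJ HJys).
suff H : ideal_exp I r0.+1 `<=` reduction_step (adjoins (zero_ideal R) ys) r0.
  apply: subset_trans H _; apply: reduction_step_mono => y Hy; left; move: y Hy.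
  by apply: adjoins_min => // _ ->; exact: ideal_zero.
have ys_n i : (n <= i)%N -> ys`_i = 0.
  by move=> le_n; rewrite nth_default // (leq_trans sz).
(* Entries past the end of [ys] default to zero, so a shorter list is a matrix with zero rows. *)
have /choice[A HA] : forall i, exists A : nat -> R, ys`_i = \sum_(j < n) A j * fs`_j.
  move=> i; apply: adjoins_coef; rewrite -Ifs; have [lt_i|le_i] := ltnP i (size ys).
    by apply/JI/ysJ/mem_nth.
  by rewrite nth_default //; exact: ideal_zero.
have [ev [ev_iota evX]] := HS (fun k => A (k %/ n)%N (k %% n)%N).
have idx (i j : 'I_n) : [/\ (i * n + j < n * n)%N, ((i * n + j) %/ n = i)%N &
    ((i * n + j) %% n = j)%N].
  have n0 : (0 < n)%N by apply: leq_ltn_trans (ltn_ord i).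
  split; last 2 first.
  - by rewrite divnMDl // divn_small // addn0.
  - by rewrite modnMDl modn_small.
  by rewrite (leq_trans (n := i.+1 * n)) ?leq_mul2r ?ltn_ord ?orbT // mulSn addnC ltn_add2r.
have evXA (i j : 'I_n) : ev (X (i * n + j)%N) = A i j.
  by have [lt_ij q_ij r_ij] := idx i j; rewrite evX // q_ij r_ij.
have evY (i : 'I_n) : ev (Y i) = ys`_i.
  rewrite HA rmorph_sum; apply: eq_bigr => j _.
  by rewrite rmorphM ev_iota evXA.
(* [P] is the point of the parameter space with coordinates [A]. The unknowns agree with [A] modulo
   [P], so Nakayama at [P] spreads the relation for [ys] to the generic rows. *)
have m1 : ~ ideal_preimage ev m 1 by rewrite /= rmorph1; exact: spec_proper.
have m_prime x y : ideal_preimage ev m (x * y) ->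
    ideal_preimage ev m x \/ ideal_preimage ev m y.
  by rewrite /= rmorphM => /spec_prime.
pose P : Spec S := PrimeIdeal m1 m_prime.
pose G := ideal_gen (iota @` ideal_exp I r.+1).
have YP (i : 'I_n) h : ideal_exp I r h ->
    ideal_sum (T r) (ideal_prod P G) (iota (ys`_i * h)).
  move=> Ih; have -> : iota (ys`_i * h) =
      Y i * iota h + \sum_(j < n) (iota (A i j) - X (i * n + j)%N) * iota (fs`_j * h).
    rewrite HA mulr_suml rmorph_sum /Y mulr_suml -big_split /=.
    by apply: eq_bigr => j _; rewrite !rmorphM; ring.
  apply: ideal_add; first by apply: ideal_sum_subl; exact: TY.
  apply: ideal_sum_subr; apply: ideal_sum_ord => j; apply: ideal_prod_mem.
    by rewrite /= rmorphB ev_iota evXA subrr; exact: ideal_zero.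
  apply: ideal_gen_mem; exists (fs`_j * h) => //.
  by apply: ideal_prod_mem => //; apply: fsI; exact: mem_nth.
have GT : G `<=` sat P (T r).
  apply: (nakayama S_noeth); apply: ideal_gen_min => _ [g Ig <-]; apply: sat_sub.
  suff : reduction_step (adjoins (zero_ideal R) ys) r `<=`
      ideal_preimage iota (ideal_sum (T r) (ideal_prod P G)) by apply; exact: HJ.
  apply: ideal_gen_min => x [|mx]; last by apply: ideal_sum_subl; exact: Tm.
  move: x; apply: ideal_prod_min => y h Hy Ih.
  suff : adjoins (zero_ideal R) ys `<=`
      transporter (ideal_preimage iota (ideal_sum (T r) (ideal_prod P G))) h by apply.
  apply: adjoins_min => [_ ->|_ /(nthP 0)[i lt_i <-]]; first exact: ideal_zero.
  exact: (YP (Ordinal (leq_trans lt_i sz))).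
have [gs gsE] := noetherian_gen R_noeth (ideal_exp I r.+1).
have [_ /mapP[g ggs ->]|u Pu Hu] := @sat_finite _ P (T r) (map iota gs).
  by apply: GT; apply: ideal_gen_mem; exists g => //; rewrite gsE; exact: adjoins_mem.
(* The chain being stable, [u] lies in [Q r0]; evaluation gives the relation for [r0] times [ev u],
   a unit modulo [m]. *)
have /Hr0 Qu : Q r u.
  apply: QP => g; rewrite gsE mulrC; move: g.
  suff : adjoins (zero_ideal R) gs `<=` ideal_preimage iota (transporter (T r) u) by apply.
  apply: adjoins_min => [_ ->|g ggs]; first exact: ideal_zero.
  suff : T r (iota g * u) by [].
  by rewrite mulrC; apply: Hu; exact: map_f.
set Z := reduction_step _ r0.
have TZ : T r0 `<=` ideal_preimage ev Z.
  apply: ideal_gen_min => s [[i [h [lt_i Ih ->]]]|[z mz ->]].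
    suff : Z (ev (Y i * iota h)) by [].
    rewrite rmorphM ev_iota (evY (Ordinal lt_i)).
    apply: ideal_sum_subl; apply: ideal_prod_mem => //=.
    have [lt_iy|le_i] := ltnP i (size ys); first by apply: adjoins_mem; exact: mem_nth.
    by rewrite nth_default //; exact: ideal_zero.
  suff : Z (ev (iota z)) by [].
  by rewrite ev_iota; exact: ideal_sum_subr.
move=> g Ig; have Zug : Z (ev (u * iota g)).
  by apply: TZ; apply: Qu; apply: ideal_gen_mem; exists g.
rewrite rmorphM ev_iota in Zug.
have [c mc] := maximal_inverse (c := ev u) Pu.
have -> : g = c * (ev u * g) + (1 - c * ev u) * g by ring.
apply: ideal_add; first exact: ideal_mul.
by apply: ideal_sum_subr; exact: ideal_prod_mem.
Qed.

End UniformReductionNumber.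

(** * Extended naturals, heights and localizations *)

(** Take [x] outside all of [Ls] and [y] outside [L]. Each of the ideals, being a subspace, contains
    at most one point [x + b *: y] of the line, and the field has further values of [b]. *)
Lemma avoidance_infinite (k : fieldType) (R : comAlgType k) :
  infinite_set [set: k] -> avoidance R.
Proof.
move=> k_inf J; elim=> [|L Ls IH] HJ; first by exists 0 => //; exact: ideal_zero.
have [x Jx Lsx] := IH (fun M HM => HJ M (or_intror HM)).
have /existsNP[y /not_implyP[Jy Ly]] := HJ L (or_introl erefl).
have scale (M : ideal R) (c : k) z : M z -> M (c *: z).
  by rewrite -mulr_algl; exact: ideal_mul.
have bad1 (M : ideal R) (b c : k) : List.In M (L :: Ls) ->
    M (x + b *: y) -> M (x + c *: y) -> b = c.
  move=> HM Mb Mc; apply: contrapT => /eqP bc.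
  have My : M y.
    have := ideal_sub Mb Mc; rewrite opprD addrACA subrr add0r -scalerBl.
    by move=> /(scale M (b - c)^-1); rewrite scalerK // subr_eq0.
  case: HM => [LM|HM]; first by apply: Ly; rewrite LM.
  apply: (Lsx M HM); apply: ideal_addrr Mb; exact: scale.
have [bs Hbs] : exists bs : seq k, forall (M : ideal R) (b : k),
    List.In M (L :: Ls) -> M (x + b *: y) -> b \in bs.
  elim: (L :: Ls) bad1 => [|M Ms IHM] bad; first by exists [::].
  have [bs Hbs] := IHM (fun N b c HN => bad N b c (or_intror HN)).
  have [[b Mb]|nb] := pselect (exists b : k, M (x + b *: y)).
    exists (b :: bs) => N c [<- Mc|HN Nc]; rewrite inE.
      by rewrite (bad M c b) ?eqxx //; left.
    by rewrite (Hbs N c) ?orbT.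
  by exists bs => N c [<- Mc|]; [case: nb; exists c|exact: Hbs].
have [b Hb] : exists b : k, b \notin bs.
  apply: contrapT => H; apply: k_inf; apply: (sub_finite_set _ (finite_seq bs)).
  by move=> b _ /=; apply: contrapT => /negP Hb; apply: H; exists b.
exists (x + b *: y); first by apply: ideal_add => //; exact: scale.
by move=> M HM Mb; move: Hb; rewrite (Hbs M b).
Qed.

Section ExtendedNaturals.
Implicit Types (A : set (\bar int)).

Lemma lee_enat m n : (enat m <= enat n)%E = (m <= n)%N.
Proof. by rewrite /enat lee_fin lez_nat. Qed.

(** The supremum is picked by choice, so its existence is proved first: a maximum if [A] is bounded,
    [+oo] if not. For empty [A] the default [-oo] makes both sides false. *)
Lemma enat_sup A n : (forall y, A y -> exists m, y = enat m) ->
  (enat n <= supremum -oo A)%E <-> exists2 m, (n <= m)%N & A (enat m).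
Proof.
move=> Anat; have [->|/set0P[y0 Ay0]] := eqVneq A set0.
  by rewrite supremum0; split=> [|[]].
have supA : supremums A !=set0.
  have [[M HM]|unb] := pselect (exists M, forall m, A (enat m) -> (m <= M)%N).
    have [m0 Em0] := Anat _ Ay0.
    have ex : exists m, `[< A (enat m) >] by exists m0; apply/asboolP; rewrite -Em0.
    have ub m : `[< A (enat m) >] -> (m <= M)%N by move/asboolP/HM.
    case: (ex_maxnP ex ub) => g /asboolP Ag gmax; exists (enat g); split.
      move=> y Ay; have [m Em] := Anat y Ay; rewrite Em lee_enat; apply: gmax.
      by apply/asboolP; rewrite -Em.
    by move=> y; apply.
  exists +oo%E; split=> [y _|y Hy]; first exact: leey.
  case: y Hy => [z| |] Hy //; last by have [m Em] := Anat _ Ay0; have := Hy _ Ay0; rewrite Em.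
  exfalso; apply: unb; exists `|z|%N => m Am.
  have := Hy _ Am; rewrite /enat lee_fin => mz; rewrite -lez_nat.
  by rewrite (le_trans mz) // abszE ler_norm.
split=> [Hn|[m nm Am]]; last first.
  apply: (le_trans (y := enat m)); first by rewrite lee_enat.
  exact: ge_supremum_Nmem.
have [ubA lubA] : supremums A (supremum -oo%E A).
  rewrite /supremum; case: ifP => [/eqP A0|_]; last exact: xgetPex.
  by rewrite A0 in Ay0.
apply: contrapT => H.
have Hlt m : A (enat m) -> (m < n)%N.
  by move=> Am; rewrite ltnNge; apply/negP => nm; apply: H; exists m.
have [m0 Em0] := Anat _ Ay0; rewrite Em0 in Ay0; have := Hlt _ Ay0.
case: n Hn {H} Hlt => [|n] // Hn Hlt _.
have : (supremum -oo A <= enat n)%E.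
  by apply: lubA => y Ay; have [m Em] := Anat y Ay; rewrite Em lee_enat -ltnS Hlt // -Em.
by move=> /(le_trans Hn); rewrite lee_enat ltnn.
Qed.

Lemma enat_inf A : (forall y, A y -> exists m, y = enat m) -> A !=set0 ->
  A (infimum +oo%E A) /\ forall y, A y -> (infimum +oo A <= y)%E.
Proof.
move=> Anat [y0 Ay0]; have [m0 Em0] := Anat _ Ay0.
have ex : exists m, `[< A (enat m) >] by exists m0; apply/asboolP; rewrite -Em0.
case: (ex_minnP ex) => g /asboolP Ag gmin.
have lbg : lbound A (enat g).
  move=> y Ay; have [m Em] := Anat y Ay; rewrite Em lee_enat; apply: gmin.
  by apply/asboolP; rewrite -Em.
have infA : infimums A !=set0 by exists (enat g); split=> // y; exact.
have [lbA glbA] : infimums A (infimum +oo%E A).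
  rewrite /infimum; case: ifP => [/eqP A0|_]; last exact: xgetPex.
  by rewrite A0 in Ay0.
have -> : infimum +oo%E A = enat g.
  by apply/eqP; rewrite eq_le lbA //= glbA.
by split.
Qed.

End ExtendedNaturals.

(** * Heights and dimensions through chains of primes *)

Section Heights.
Variable R : comPzRingType.
Implicit Types (p q : Spec R) (I K : ideal R).

Lemma prime_chain_height n (c : nat -> Spec R) p :
  prime_chain n c -> c n = p :> set R -> height_geq n p.
Proof.
elim: n p => [|n IH] p //= Hc cp; exists (c n).
  by rewrite -cp; exact: Hc.
by apply: IH => // i ltin; apply: Hc; exact: ltnW.
Qed.

Lemma height_geq_chain n p :
  height_geq n p -> exists2 c, prime_chain n c & c n = p :> set R.
Proof.
elim: n p => [|n IH] p /=; first by exists (fun=> p).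
move=> [q qp /IH[c Hc cq]]; exists (fun i => if (i <= n)%N then c i else p).
  move=> i; rewrite ltnS /= leqNgt; case: (ltngtP i n) => //= [ltin _|-> _].
    exact: Hc.
  by rewrite cq.
by rewrite /= ltnn.
Qed.

Lemma enat_le_height_prime n p : (enat n <= height_prime p)%E <-> height_geq n p.
Proof.
rewrite /height_prime; split=> [/enat_sup[|m nm [m' [c Hc cp] E]]|Hn].
- by move=> y [m _ <-]; exists m.
- apply: height_geq_leq nm _; move: E => [<-].
  exact: prime_chain_height cp.
- apply/enat_sup; first by move=> y [m _ <-]; exists m.
  by exists n => //; exists n => //; have [c] := height_geq_chain Hn; exists c.
Qed.

Lemma enat_le_krull_dim n : (enat n <= krull_dim R)%E <-> exists p : Spec R, height_geq n p.
Proof.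
rewrite /krull_dim; split=> [/enat_sup[|m nm [m' [c Hc] E]]|[p Hp]].
- by move=> y [m _ <-]; exists m.
- exists (c m'); apply: height_geq_leq nm _; move: E => [<-].
  exact: prime_chain_height Hc _.
- apply/enat_sup; first by move=> y [m _ <-]; exists m.
  by exists n => //; exists n => //; have [c Hc _] := height_geq_chain Hp; exists c.
Qed.

Variable d : nat.
Hypothesis R_dim : krull_dim R = enat d.

Lemma height_leq_dim n p : height_geq n p -> (n <= d)%N.
Proof. by move=> Hn; rewrite -lee_enat -R_dim; apply/enat_le_krull_dim; exists p. Qed.

Lemma height_primeE p : exists2 g, height_prime p = enat g &
  forall n, height_geq n p <-> (n <= g)%N.
Proof.
have [g Hg gmax] := height_max (fun n => @height_leq_dim n p).
exists g => [|n]; last by split=> [/gmax//|ng]; exact: height_geq_leq ng Hg.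
have := (enat_le_height_prime g p).2 Hg.
have : ~ (enat g.+1 <= height_prime p)%E.
  by move=> /enat_le_height_prime/gmax; rewrite ltnn.
case: (height_prime p) => [z| |] //; rewrite /enat !lee_fin => /negP.
by rewrite -ltNge intS addrC ltzD1 => zg gz; congr (_%:E); apply/eqP; rewrite eq_le zg.
Qed.

Lemma enat_le_height n K :
  (enat n <= height K)%E <-> forall p, K `<=` p -> height_geq n p.
Proof.
rewrite /height; set A := [set _ | _ in _].
have Anat y : A y -> exists m, y = enat m.
  by move=> [p _ <-]; have [g -> _] := height_primeE p; exists g.
split=> [Hn p Kp|HK].
  apply/enat_le_height_prime; apply: le_trans Hn _.
  have Ap : A (height_prime p) by exists p.
  by apply: (enat_inf Anat _).2 => //; exists (height_prime p).
have [->|/set0P A0] := eqVneq A set0.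
  by rewrite /infimum eqxx leey.
have [p Kp <-] := (enat_inf Anat A0).1.
by apply/enat_le_height_prime; exact: HK.
Qed.

Lemma enat_lt_height n K :
  (enat n < height K)%E <-> forall p, K `<=` p -> height_geq n.+1 p.
Proof.
by rewrite -enat_le_height; case: (height K).
Qed.

End Heights.

(* [f] presents [A] as the localization of [R / K] at [p]. *)
Record is_localization (R A : comPzRingType) (f : {rmorphism R -> A})
    (p : Spec R) (K : ideal R) : Prop := IsLocalization {
  loc_ker : forall a, f a = 0 <-> sat p K a;
  loc_unit : forall s, ~ p s -> exists t, f s * t = 1;
  loc_surj : forall x, exists a s, ~ p s /\ x * f s = f a }.

(** * Ideals of a localization seen in the base ring *)

Section LocalizationTransfer.
Variables (R A : comPzRingType) (f : {rmorphism R -> A}) (p : Spec R) (K : ideal R).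
Hypothesis f_loc : is_localization f p K.
Implicit Types (D J : ideal R) (E : ideal A) (q : Spec R).

Definition contracts E D : Prop := forall a, E (f a) <-> sat p D a.

Lemma contracts0 : contracts (zero_ideal A) K.
Proof. by move=> a; exact: (loc_ker f_loc). Qed.

Lemma contracts_cancel E s x : ~ p s -> E (x * f s) -> E x.
Proof.
move=> /(loc_unit f_loc)[t st] Exs.
have -> : x = t * (x * f s) by rewrite mulrCA [t * _]mulrC st mulr1.
exact: ideal_mul.
Qed.

Lemma contracts_adjoin E D x y s : contracts E D -> ~ p s -> x * f s = f y ->
  contracts (adjoin E x) (adjoin D y).
Proof.
move=> DE ps xy a; split=> [[z [b [Ez aE]]]|[u [pu [z [b [Dz uE]]]]]].
  have [c [t [pt bc]]] := loc_surj f_loc b.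
  have : E (f (a * (t * s) - c * y)).
    have -> : f (a * (t * s) - c * y) = f (t * s) * z.
      by rewrite rmorphB !rmorphM aE -bc -xy; ring.
    exact: ideal_mul.
  move=> /DE[u [pu Du]]; exists (u * (t * s)); split.
    by do 2! apply: spec_mulN => //.
  exists (u * (a * (t * s) - c * y)), (u * c); split=> //; ring.
apply: (contracts_cancel pu); rewrite -rmorphM mulrC uE rmorphD rmorphM -xy.
apply: ideal_add; first by apply: adjoin_sub; apply/DE; exact: sat_sub.
by rewrite mulrA mulrAC; apply: ideal_mul; exact: adjoin_mem.
Qed.

Lemma contracts_nzd E D x y s : contracts E D -> ~ p s -> x * f s = f y ->
  (forall z, E (x * z) -> E z) -> nonzerodivisor (sat p D) y.
Proof.
move=> DE ps xy Hx a /DE; rewrite rmorphM -xy -mulrA => /Hx.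
by rewrite mulrC => /(contracts_cancel ps)/DE.
Qed.

Lemma regular_sequence_contract E D (xs : seq A) : contracts E D ->
  (forall i, (i < size xs)%N -> forall z,
    adjoins E (take i xs) (xs`_i * z) -> adjoins E (take i xs) z) ->
  (forall x a s, x \in xs -> ~ p s -> x * f s = f a -> p a) ->
  exists2 ys, size ys = size xs & regular_at p D ys.
Proof.
elim: xs E D => [|x xs IH] E D DE Hreg Hp; first by exists [::].
have [y [s [ps xy]]] := loc_surj f_loc x.
have [||ys sz Hys] := IH _ _ (contracts_adjoin DE ps xy).
- by move=> i lt_i; exact: (Hreg i.+1).
- by move=> x' a t x'xs; apply: Hp; rewrite inE x'xs orbT.
exists (y :: ys) => /=; first by rewrite sz.
split=> //; first by apply: (Hp x y s); rewrite ?mem_head.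
by apply: contracts_nzd DE ps xy _ => z; exact: (Hreg 0%N).
Qed.

Definition extend (J : ideal R) : ideal A.
Proof.
exists [set x | exists a s, [/\ ~ p s, J a & x * f s = f a]].
- exists 0, 1; rewrite mul0r rmorph0; split=> //; first exact: spec_proper.
  exact: ideal_zero.
- move=> x y [a [s [ps Ja xa]]] [b [t [pt Jb yb]]].
  exists (t * a + s * b), (s * t); split; first exact: spec_mulN.
    by apply: ideal_add; exact: ideal_mul.
  by rewrite rmorphD !rmorphM -xa -yb; ring.
- move=> x y [b [t [pt Jb yb]]]; have [a [s [ps xa]]] := loc_surj f_loc x.
  exists (a * b), (s * t); split; [exact: spec_mulN|exact: ideal_mul|].
  by rewrite !rmorphM -xa -yb; ring.
Defined.

Lemma extend_contracts J : K `<=` J -> contracts (extend J) J.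
Proof.
move=> KJ x; split=> [[a [s [ps Ja xa]]]|[u [pu Ju]]]; last first.
  by exists (u * x), u; split=> //; rewrite rmorphM mulrC.
have /(loc_ker f_loc)[u [pu Ku]] : f (x * s - a) = 0.
  by rewrite rmorphB rmorphM xa subrr.
exists (u * s); split; first exact: spec_mulN.
have -> : u * s * x = u * (x * s - a) + u * a by ring.
by apply: ideal_add; [exact: KJ|exact: ideal_mul].
Qed.

Lemma extend_spec q : K `<=` q -> q `<=` p ->
  exists Q : Spec A, forall a, Q (f a) <-> q a.
Proof.
move=> Kq qp; have Hq a : extend q (f a) <-> q a.
  by rewrite (extend_contracts Kq); split=> [/(sat_spec qp)|/sat_sub//] [s [qs /spec_prime[]]].
have Q1 : ~ extend q 1 by rewrite -(rmorph1 f) => /Hq; exact: spec_proper.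
have Q_prime x y : extend q (x * y) -> extend q x \/ extend q y.
  have [a [s [ps xa]]] := loc_surj f_loc x; have [b [t [pt yb]]] := loc_surj f_loc y.
  move=> Hxy; have : extend q (f (a * b)).
    have -> : f (a * b) = f s * f t * (x * y) by rewrite rmorphM -xa -yb; ring.
    exact: ideal_mul.
  move=> /Hq/spec_prime[qa|qb]; [left|right].
    by exists a, s.
  by exists b, t.
by exists (PrimeIdeal Q1 Q_prime).
Qed.

Lemma contract_proper q q' (Q Q' : Spec A) : (forall a, Q (f a) <-> q a) ->
  (forall a, Q' (f a) <-> q' a) -> q `<` q' -> Q `<` Q'.
Proof.
move=> HQ HQ' [qq' q'q]; split=> [x Qx|Q'Q]; last first.
  by apply: q'q => a /HQ'/Q'Q/HQ.
have [a [s [ps xa]]] := loc_surj f_loc x.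
apply: (contracts_cancel ps); rewrite xa; apply/HQ'/qq'/HQ; rewrite -xa.
exact: ideal_mulr.
Qed.

Lemma extend_height_geq n q (Q : Spec A) : (forall r : Spec R, K `<=` r) ->
  q `<=` p -> (forall a, Q (f a) <-> q a) -> height_geq n q -> height_geq n Q.
Proof.
move=> HK; elim: n q Q => [|n IH] q Q //= qp HQ [q' q'q Hq'].
have q'p : q' `<=` p by exact: subset_trans q'q.1 qp.
have [Q' HQ'] := extend_spec (HK q') q'p; exists Q'; first exact: contract_proper q'q.
exact: IH Hq'.
Qed.

End LocalizationTransfer.

Section LocalizationOfRing.
Variables (R : comPzRingType) (p : Spec R).
Implicit Types (J : ideal R).

Definition make_denominator (s : R) (ps : ~ p s) : denominator p :=
  exist _ s (asboolT ps).

Lemma loc_map_frac a (s : denominator p) : Defs.frac a s * loc_map p (val s) = loc_map p a.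
Proof.
rewrite -[LHS]/(loc_mul _ _) /loc_map loc_mulE; apply/fracP.
by exists (denominator1 p) => /=; ring.
Qed.

Lemma loc_map_is_localization : is_localization (loc_map p) p (zero_ideal R).
Proof.
split=> [a|s ps|x].
- rewrite -[0 : localization p]/(Defs.frac 0 (denominator1 p)); split.
    move=> /fracP[u /= Hu]; exists (val u); split; first exact: denominatorP.
    by move: Hu; rewrite mulr1 mul0r mulr0.
  move=> [s [ps sa]]; apply/fracP; exists (make_denominator ps) => /=.
  by rewrite mulr1 mul0r mulr0; exact: sa.
- exists (Defs.frac 1 (make_denominator ps)).
  by rewrite mulrC; exact: (loc_map_frac 1 (make_denominator ps)).
- elim/localization_ind: x => a s; exists a, (val s); split; first exact: denominatorP.
  exact: loc_map_frac.
Qed.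

Lemma ideal_locE J : ideal_loc p J = extend loc_map_is_localization J.
Proof.
apply: ideal_eqP.
  apply: ideal_gen_min => _ [a Ja <-]; exists a, 1; rewrite rmorph1 mulr1.
  by split=> //; exact: spec_proper.
move=> x [a [s [ps Ja xa]]].
apply: (contracts_cancel loc_map_is_localization ps); rewrite xa.
by apply: ideal_gen_mem; exists a.
Qed.

Lemma ideal_locP J x : ideal_loc p J x <->
  exists a s, [/\ ~ p s, J a & x * loc_map p s = loc_map p a].
Proof. by rewrite ideal_locE. Qed.

Lemma ideal_loc_map J a : ideal_loc p J (loc_map p a) <-> sat p J a.
Proof.
by rewrite ideal_locE; apply: extend_contracts => _ ->; exact: ideal_zero.
Qed.

Lemma quotient_spec (K : ideal R) : K `<=` p ->
  exists P : Spec (quotient K), forall a, P (quotient_map K a) <-> p a.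
Proof.
move=> Kp.
have repr_p a : p (quotient_repr (quotient_map K a)) <-> p a.
  have /quotient_mapP/Kp Hp := quotient_reprK (quotient_map K a).
  split=> [pr|pa].
    by rewrite -(subKr (quotient_repr (quotient_map K a)) a); exact: ideal_sub.
  by rewrite -(subrK a (quotient_repr _)); exact: ideal_add.
unshelve epose (P := Ideal (ideal_set := fun x : quotient K => p (quotient_repr x)) _ _ _).
- by rewrite -(rmorph0 (quotient_map K)); apply/repr_p; exact: ideal_zero.
- elim/quotient_ind=> x; elim/quotient_ind=> y /repr_p px /repr_p py.
  by rewrite -rmorphD; apply/repr_p; exact: ideal_add.
- elim/quotient_ind=> x; elim/quotient_ind=> y /repr_p py.
  by rewrite -rmorphM; apply/repr_p; exact: ideal_mul.
have P1 : ~ P 1.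
  by rewrite -(rmorph1 (quotient_map K)) => /repr_p; exact: spec_proper.
have P_prime x y : P (x * y) -> P x \/ P y.
  elim/quotient_ind: x => x; elim/quotient_ind: y => y.
  by rewrite -rmorphM => /repr_p/spec_prime[]; [left|right]; apply/repr_p.
by exists (PrimeIdeal P1 P_prime) => a; exact: repr_p.
Qed.

Lemma quotient_map_eq0 (K : ideal R) a : quotient_map K a = 0 <-> K a.
Proof.
by rewrite -(rmorph0 (quotient_map K)) -[K a](congr1 K (subr0 a)); exact: quotient_mapP.
Qed.

End LocalizationOfRing.

(** A single map from [R] presents the localized quotient, so depth there is read off in [R] in one
    step. *)
Lemma quotient_is_localization (R : comPzRingType) (p : Spec R) (K : ideal R)
  (P : Spec (quotient K)) : (forall a, P (quotient_map K a) <-> p a) ->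
  is_localization (loc_map P \o quotient_map K) p K.
Proof.
move=> PE; have P_loc := loc_map_is_localization P; split=> [a|s ps|x].
- split=> [/(loc_ker P_loc)[u [Pu]]|[s [ps Ks]]].
    elim/quotient_ind: u Pu => s Ps; rewrite -rmorphM => /quotient_map_eq0 Ks.
    by exists s; split=> // /PE.
  apply/(loc_ker P_loc); exists (quotient_map K s); split; first by move/PE.
  by rewrite -rmorphM; apply/quotient_map_eq0.
- by apply: (loc_unit P_loc) => /PE.
- have [a [s [Ps xa]]] := loc_surj P_loc x.
  elim/quotient_ind: a xa => a; elim/quotient_ind: s Ps => s Ps xa.
  by exists a, s; split=> // /PE.
Qed.

(** * Depth conditions as regular sequences in [R] *)

Lemma depth_regular_at (R A : comPzRingType) (f : {rmorphism R -> A})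
  (p : Spec R) (K : ideal R) (J : ideal A) n : is_localization f p K ->
  (forall x a s, J x -> ~ p s -> x * f s = f a -> p a) ->
  (enat n <= depth J)%E -> exists2 ys, (n <= size ys)%N & regular_at p K ys.
Proof.
move=> f_loc Jp; rewrite /depth => /enat_sup[|m nm [xs [[_ Hreg] xsJ] [E]]].
  by move=> y [xs _ <-]; exists (size xs).
have xs_reg i : (i < size xs)%N -> forall z,
    adjoins (zero_ideal A) (take i xs) (xs`_i * z) ->
    adjoins (zero_ideal A) (take i xs) z.
  by move=> lt_i z; rewrite -ideal_gen_seq; exact: Hreg.
have xs_p x a s : x \in xs -> ~ p s -> x * f s = f a -> p a.
  by move=> /xsJ; exact: Jp.
have [ys sz Hys] := regular_sequence_contract f_loc (contracts0 f_loc) xs_reg xs_p.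
by exists ys => //; rewrite sz E.
Qed.

Lemma depth_at_regular_at (R : comPzRingType) (p : Spec R) n :
  (enat n <= depth_at p)%E ->
  exists2 ys, (n <= size ys)%N & regular_at p (zero_ideal R) ys.
Proof.
apply: depth_regular_at (loc_map_is_localization p) _ => x a s px ps xa.
have : ideal_loc p p (loc_map p a) by rewrite -xa; exact: ideal_mulr.
by move=> /ideal_loc_map[u [pu /spec_prime[]]].
Qed.

Lemma maximal_exists (R : comPzRingType) (p : Spec R) : noetherian R ->
  exists2 m : Spec R, maximal m & p `<=` m.
Proof.
move=> R_noeth; move eI : (p : ideal R) => I.
elim/(noetherian_ind R_noeth): I p eI => I IH p eI.
have [p_max|] := pselect (maximal p); first by exists p; rewrite // eI.
move=> /existsNP[J /not_implyP[pJ /not_implyP[J1 Jp]]].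
have [q Jq _] := associated_exists R_noeth J1; have JqS := associated_sub Jq.
have [|||m m_max qm] := IH q _ _ q.
- by rewrite -eI; exact: subset_trans JqS.
- by rewrite -eI => qp; apply: Jp; exact: subset_trans qp.
- by [].
by exists m => //; rewrite -eI; apply: subset_trans qm; exact: subset_trans JqS.
Qed.

(** Depth equals dimension by hypothesis at a maximal ideal above [p], and the property descends to
    smaller primes. *)
Lemma cohen_macaulay_atP (R : comPzRingType) (d : nat) (p : Spec R) :
  avoidance R -> cohen_macaulay R -> krull_dim R = enat d -> cohen_macaulay_at p.
Proof.
move=> R_avoid [R_noeth R_CM] R_dim.
have [m m_max pm] := maximal_exists p R_noeth.
apply: (cohen_macaulay_at_sub R_noeth R_avoid) pm.
have [h Hh hmax] := height_max (fun n => @height_leq_dim _ _ R_dim n m).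
have m_loc := loc_map_is_localization m.
have zero_sub (q : Spec R) : zero_ideal R `<=` q by move=> _ ->; exact: ideal_zero.
have [Q HQ] := extend_spec m_loc (zero_sub m) (@subset_refl _ m).
have hdim : (enat h <= krull_dim (localization m))%E.
  by apply/enat_le_krull_dim; exists Q; apply: (extend_height_geq m_loc) HQ Hh.
rewrite -(R_CM m m_max) in hdim.
have [us sz Hus] := depth_at_regular_at hdim.
by exists us => // n /hmax nh; exact: leq_trans sz.
Qed.

Lemma serre_S2_regular_at (R : comPzRingType) (K : ideal R) (p q0 q1 : Spec R) :
  serre_S 2 (quotient K) -> K `<=` q0 -> q0 `<` q1 -> q1 `<` p ->
  exists u v, regular_at p K [:: u; v].
Proof.
move=> S2 Kq0 q01 q1p; have Kq1 : K `<=` q1 by exact: subset_trans q01.1.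
have Kp : K `<=` p by exact: subset_trans q1p.1.
have [P PE] := quotient_spec Kp; have P_loc := quotient_is_localization PE.
have [Q HQ] := extend_spec P_loc Kp (@subset_refl _ p).
have [Q1 HQ1] := extend_spec P_loc Kq1 q1p.1.
have [Q0 HQ0] := extend_spec P_loc Kq0 (subset_trans q01.1 q1p.1).
have dim2 : (enat 2 <= krull_dim (localization P))%E.
  apply/enat_le_krull_dim; exists Q; exists Q1; first exact: (contract_proper P_loc HQ1 HQ q1p).
  by exists Q0 => //; exact: (contract_proper P_loc HQ0 HQ1 q01).
have := S2 P; rewrite (min_idPl dim2) => depth2.
have [|[|u [|v ys]] // _ [pu Ku [pv Kv _]]] := depth_regular_at P_loc _ depth2.
  move=> x a s px ps xa.
  have : ideal_loc P P (loc_map P (quotient_map K a)).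
    by rewrite -[loc_map P _]xa; exact: ideal_mulr.
  by move=> /ideal_loc_map[u [Pu /spec_prime[|/PE]]].
by exists u, v.
Qed.

(** * The core *)

Section Reductions.
Variable R : comPzRingType.
Implicit Types (I J : ideal R) (p : Spec R).

Lemma ideal_exp_prod J I r : J `<=` I ->
  ideal_prod J (ideal_exp I r) `<=` ideal_exp I r.+1.
Proof. by move=> JI; exact: ideal_prod_mono. Qed.

Lemma ideal_exp_prodS J I r : ideal_exp I r.+1 `<=` ideal_prod J (ideal_exp I r) ->
  ideal_exp I r.+2 `<=` ideal_prod J (ideal_exp I r.+1).
Proof.
move=> HI; apply: ideal_prod_min => x y Ix /HI; rewrite mulrC; move: y.
apply: ideal_prod_transporter => u v Ju Iv; rewrite -mulrA [v * x]mulrC.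
by apply: ideal_prod_mem => //; exact: ideal_prod_mem.
Qed.

Lemma reduction_intro J I r : J `<=` I ->
  ideal_exp I r.+1 `<=` ideal_prod J (ideal_exp I r) -> reduction J I.
Proof.
move=> JI HI; split=> //; exists r => m rm.
suff H : ideal_exp I m.+1 `<=` ideal_prod J (ideal_exp I m).
  by apply/seteqP; split=> //; exact: ideal_exp_prod.
by rewrite -(subnK rm); elim: (m - r)%N => [|n IH] //; exact: ideal_exp_prodS.
Qed.

Lemma reduction_elim J I : reduction J I ->
  J `<=` I /\ exists r, ideal_exp I r.+1 `<=` ideal_prod J (ideal_exp I r).
Proof. by move=> [JI [r Hr]]; split=> //; exists r; rewrite Hr. Qed.

Lemma reduction_refl I : reduction I I.
Proof. exact: (reduction_intro (r := 0)). Qed.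

Lemma core_sub I : core I `<=` I.
Proof. by move=> x; apply; exact: reduction_refl. Qed.

End Reductions.

Section LocalizedReductions.
Variable R : comPzRingType.
Implicit Types (I J : ideal R) (p : Spec R).

Lemma ideal_loc_mono p I J : I `<=` J -> ideal_loc p I `<=` ideal_loc p J.
Proof.
by move=> IJ; apply: ideal_gen_min => _ [a Ia <-]; apply: ideal_gen_mem; exists a; auto.
Qed.

Lemma ideal_loc_prod p I J :
  ideal_loc p (ideal_prod I J) = ideal_prod (ideal_loc p I) (ideal_loc p J).
Proof.
apply: ideal_eqP.
  apply: ideal_gen_min => _ [a Ha <-]; move: a Ha.
  suff : ideal_prod I J `<=` ideal_preimage (loc_map p)
    (ideal_prod (ideal_loc p I) (ideal_loc p J)) by apply.
  apply: ideal_prod_min => x y Ix Jy.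
  suff : ideal_prod (ideal_loc p I) (ideal_loc p J) (loc_map p (x * y)) by [].
  by rewrite rmorphM; apply: ideal_prod_mem; apply: ideal_gen_mem; [exists x|exists y].
apply: ideal_prod_gen_min => _ _ [x Ix <-] [y Jy <-].
by rewrite -rmorphM; apply: ideal_gen_mem; exists (x * y) => //; exact: ideal_prod_mem.
Qed.

Lemma ideal_loc_exp p I n : ideal_loc p (ideal_exp I n) = ideal_exp (ideal_loc p I) n.
Proof.
elim: n => [|n IH] /=; last by rewrite ideal_loc_prod IH.
apply: ideal_eqP => x _; first exact: full_idealP.
apply: ideal_full; rewrite -(rmorph1 (loc_map p)); apply: ideal_gen_mem.
by exists 1 => //; exact: full_idealP.
Qed.

Lemma reduction_loc p J I : reduction J I -> reduction (ideal_loc p J) (ideal_loc p I).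
Proof.
move=> /reduction_elim[JI [r Hr]]; apply: (reduction_intro (r := r)).
  exact: ideal_loc_mono.
by rewrite -!ideal_loc_exp -ideal_loc_prod; exact: ideal_loc_mono.
Qed.

Lemma generated_by_loc p I n : generated_by n (ideal_loc p I) ->
  generated_at I p (zero_ideal R) n.
Proof.
move=> [ts ts_gen]; have p_loc := loc_map_is_localization p.
have {ts_gen} tsE : ideal_loc p I = adjoins (zero_ideal _) ts.
  by rewrite -ideal_gen_seq; exact: ideal_ext.
have tsI x : x \in tval ts -> ideal_loc p I x by rewrite tsE; exact: adjoins_mem.
suff [fs [sz fsI Hfs]] : exists fs, [/\ size fs = size ts,
    forall z, z \in fs -> I z &
    contracts (loc_map p) p (adjoins (zero_ideal _) ts) (adjoins (zero_ideal R) fs)].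
  exists fs; split=> // [|y Iy]; first by rewrite sz size_tuple.
  by apply/Hfs; rewrite -tsE; apply: ideal_gen_mem; exists y.
elim: (tval ts) (zero_ideal _) (zero_ideal R) (contracts0 p_loc) tsI => [|x xs IH] E D ED HI.
  by exists [::]; split.
have /ideal_locP[a [s [ps Ia xa]]] := HI x (mem_head _ _).
have [fs [sz fsI Hfs]] := IH _ _ (contracts_adjoin p_loc ED ps xa)
  (fun y yxs => HI y (mem_behead (s := x :: xs) yxs)).
exists (a :: fs); split=> //=; first by rewrite sz.
by move=> z; rewrite inE => /orP[/eqP->|/fsI].
Qed.

End LocalizedReductions.

(** Where the chain of the ideals [E : b^n] stabilizes, [b] is a nonzerodivisor; but every
    associated prime of that ideal lies between [E] and [p] and so contains [b]. *)
Lemma power_mem_saturated (R : comPzRingType) (p : Spec R) (E : ideal R) b :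
  noetherian R -> saturated p E ->
  (forall q : Spec R, E `<=` q -> q `<=` p -> q b) -> exists n, E (b ^+ n).
Proof.
move=> R_noeth Ep Hq; pose F n := transporter E (b ^+ n).
have F_incr n : F n `<=` F n.+1.
  by move=> x Ex; rewrite /F /= exprSr mulrA; exact: ideal_mulr.
have [n Fn] := noetherian_chain R_noeth F_incr; exists n.
apply: contrapT => En; have [|q Fq _] := @associated_exists _ R_noeth (F n) 1.
  by rewrite /F /= mul1r.
have Fp : saturated p (F n).
  move=> x [u [pu Fux]]; apply: (saturated_mul Ep pu); by rewrite mulrA.
have [w qw] := Fq; have qb : q b.
  apply: Hq (associated_saturated Fp Fq) => x Ex; apply: (associated_sub Fq).
  exact: ideal_mulr.
apply: (@spec_proper _ q); apply/qw; rewrite mul1r; apply: (Fn n.+1).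
by move/qw: qb; rewrite /F /= exprS mulrA [w * b]mulrC.
Qed.

(** * Localizing the core *)

Section CoreLocalization.
Variable R : comNzRingType.
Variables (d : nat) (I : ideal R) (xs : seq R).
Hypothesis R_noeth : noetherian R.
Hypothesis heights : forall n (p : Spec R), height_geq n p -> (n <= d)%N.
Hypothesis xsI : forall z, z \in xs -> I z.
Hypothesis xs_dseq : d_sequence I xs.
Let c : ideal R := colon (adjoins (zero_ideal R) xs) I.
Hypothesis c_height : forall p : Spec R, c `<=` p -> height_geq d p.
Implicit Types (J : ideal R) (p q m : Spec R).

Lemma colon_maximal p q : c `<=` p -> p `<=` q -> q = p.
Proof.
move=> cp pq; apply: spec_ext; apply/seteqP; split=> //; apply: contrapT => qp.
have : height_geq d.+1 q by exists p => //; exact: c_height.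
by move/heights; rewrite ltnn.
Qed.

Lemma colon_is_maximal p : c `<=` p -> maximal p.
Proof.
move=> cp J pJ J1; have [q Jq _] := associated_exists R_noeth J1.
have JqS := associated_sub Jq.
by rewrite -(colon_maximal cp (subset_trans pJ JqS)).
Qed.

(** Yields finiteness: the primes containing [c] are maximal, hence minimal over [c] and among its
    associated primes. *)
Lemma colon_associated p : c `<=` p -> associated c p.
Proof.
move=> cp; have [|q [cq qp _]] := @associated_below _ R_noeth c p 1.
  by move=> x; rewrite mulr1; exact: cp.
by rewrite (colon_maximal (associated_sub cq) qp).
Qed.

Lemma reduction_step_leq m J r r' : (r <= r')%N ->
  ideal_exp I r.+1 `<=` reduction_step m I J r ->
  ideal_exp I r'.+1 `<=` reduction_step m I J r'.
Proof.
move=> rr' Hr; rewrite -(subnK rr'); elim: (r' - r)%N => [|n IH] //.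
rewrite addSn; apply: ideal_prod_min => u v Iu /IH; rewrite mulrC; move: v.
suff : reduction_step m I J (n + r) `<=` transporter (reduction_step m I J (n + r).+1) u.
  by apply.
apply: ideal_gen_min => x [|].
  move: x; apply: ideal_prod_transporter => a b Ja Ib.
  by rewrite -mulrA [b * u]mulrC; apply: ideal_sum_subl; do 2! apply: ideal_prod_mem => //.
move: x; apply: ideal_prod_transporter => a b ma Ib.
by rewrite -mulrA [b * u]mulrC; apply: ideal_sum_subr; do 2! apply: ideal_prod_mem => //.
Qed.

Lemma uniform_reduction_step : exists r0, forall m, c `<=` m ->
  forall J r, J `<=` I -> ideal_exp I r.+1 `<=` reduction_step m I J r ->
  ideal_exp I r0.+1 `<=` reduction_step m I J r0.
Proof.
have [Ps HPs] := associated_finite R_noeth c.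
suff [r0 Hr0] : exists r0, forall m, List.In m Ps -> c `<=` m ->
    forall J r, J `<=` I -> ideal_exp I r.+1 `<=` reduction_step m I J r ->
    ideal_exp I r0.+1 `<=` reduction_step m I J r0.
  by exists r0 => m cm; apply: Hr0 => //; apply: HPs; exact: colon_associated.
elim: {HPs}Ps => [|p Ps [r1 Hr1]]; first by exists 0%N.
have [cp|cp] := pselect (c `<=` p); last by exists r1 => m [<-|/Hr1].
have [r2 Hr2] := uniform_reduction_number R_noeth I (colon_is_maximal cp).
exists (maxn r1 r2) => m [<- _|Hm cm] J r JI Hr.
  by apply: reduction_step_leq (Hr2 _ _ JI Hr); exact: leq_maxr.
by apply: reduction_step_leq (Hr1 _ Hm cm _ _ JI Hr); exact: leq_maxl.
Qed.

Lemma reduction_colon_power J r s : J `<=` I ->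
  (forall y, ideal_exp I r.+1 y -> ideal_prod J (ideal_exp I r) (s * y)) ->
  forall gamma, c gamma -> forall y, I y ->
  J (s ^+ reduction_exponent r (size xs) *
     gamma ^+ (r.+1 * reduction_exponent r (size xs)).+1 * y).
Proof.
move=> JI HJ gamma cg y Iy.
have := reduction_bound xsI xs_dseq JI cg HJ Iy.
rewrite exprMn -exprM exprS.
set e := reduction_exponent _ _; set g := gamma ^+ (_ * _).
by have -> : g * s ^+ e * gamma * y = s ^+ e * (gamma * g) * y by ring.
Qed.

(** The bound on powers is used twice. With the number [r] of the given [J], it shows that the
    inclusion of [I^(r0+1)] in [J I^r0] can fail only at primes containing [c], where [r0] and
    Nakayama establish it. With [r0] it then gives an exponent independent of [J]. *)
Lemma uniform_colon_power : exists N, forall J gamma y,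
  reduction J I -> c gamma -> I y -> J (gamma ^+ N * y).
Proof.
have [r0 Hr0] := uniform_reduction_step.
exists (r0.+1 * reduction_exponent r0 (size xs)).+1 => J gamma y redJ cg Iy.
have [JI [r Hr]] := reduction_elim redJ.
suff HJ z : ideal_exp I r0.+1 z -> ideal_prod J (ideal_exp I r0) (1 * z).
  by have := reduction_colon_power JI HJ cg Iy; rewrite expr1n mul1r.
move=> Iz; rewrite mul1r; apply: contrapT => Jz.
have [m Jm Hm] := associated_exists R_noeth Jz.
have cm : c `<=` m.
  have HJ1 x : ideal_exp I r.+1 x -> ideal_prod J (ideal_exp I r) (1 * x).
    by rewrite mul1r; exact: Hr.
  move=> b cb; apply: (spec_exp (n := (r.+1 * reduction_exponent r (size xs)).+1)).
  apply: Hm; rewrite mulrC; move: z Iz {Jz}; apply: ideal_prod_transporter => u v Iu Iv.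
  rewrite mulrAC; apply: ideal_prod_mem => //.
  have := reduction_colon_power JI HJ1 cb Iu.
  by rewrite expr1n mul1r mulrC.
have HI : ideal_exp I r0.+1 `<=` sat m (ideal_prod J (ideal_exp I r0)).
  apply: (nakayama R_noeth) => x Ix; apply: sat_sub.
  apply: (Hr0 m cm J r JI) => // w /Hr; exact: ideal_sum_subl.
by have [u [mu /Hm]] := HI z Iz.
Qed.

Section AtPrime.
Variable p : Spec R.
Implicit Types L : ideal (localization p).

Definition contract (L : ideal (localization p)) : ideal R :=
  ideal_meet I (ideal_preimage (loc_map p) L).

Lemma contract_saturated L s y : ~ p s -> I y -> contract L (s * y) -> contract L y.
Proof.
move=> ps Iy [_ Lsy]; split=> //.
apply: (contracts_cancel (loc_map_is_localization p) ps) => /=.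
by move: Lsy; rewrite /= rmorphM mulrC.
Qed.

(** The contraction need not be a reduction of [I]; finitely many generators of [I^(r+1)] let one
    [s] outside [p] repair the equation. *)
Lemma reduction_contract L : reduction L (ideal_loc p I) ->
  exists r s, ~ p s /\ forall y, ideal_exp I r.+1 y ->
    ideal_prod (contract L) (ideal_exp I r) (s * y).
Proof.
move=> /reduction_elim[LI [r]]; rewrite -!ideal_loc_exp => Hr; exists r.
have HL : L `<=` ideal_loc p (contract L).
  move=> x Lx; have /ideal_locP[a [s [ps Ia xa]]] := LI x Lx.
  apply/ideal_locP; exists a, s; split=> //; split=> //.
  suff : L (loc_map p a) by [].
  by rewrite -xa; exact: ideal_mulr.
have Hsat y : ideal_exp I r.+1 y -> sat p (ideal_prod (contract L) (ideal_exp I r)) y.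
  move=> Iy; apply/ideal_loc_map; rewrite ideal_loc_prod.
  have : ideal_loc p (ideal_exp I r.+1) (loc_map p y) by apply: ideal_gen_mem; exists y.
  by move=> /Hr; apply: ideal_prod_mono.
have [gs gsE] := noetherian_gen R_noeth (ideal_exp I r.+1).
have [g ggs|s ps Hs] := @sat_finite _ p (ideal_prod (contract L) (ideal_exp I r)) gs.
  by apply: Hsat; rewrite gsE; exact: adjoins_mem.
exists s; split=> // y; rewrite gsE mulrC; move: y.
suff : adjoins (zero_ideal R) gs `<=`
  transporter (ideal_prod (contract L) (ideal_exp I r)) s by apply.
apply: adjoins_min => [_ ->|g ggs]; first exact: ideal_zero.
suff : ideal_prod (contract L) (ideal_exp I r) (g * s) by [].
by rewrite mulrC; exact: Hs.
Qed.

Lemma contract_colon_power L : reduction L (ideal_loc p I) ->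
  exists N, forall gamma y, c gamma -> I y -> contract L (gamma ^+ N * y).
Proof.
move=> redL; have [r [s [ps HJ]]] := reduction_contract redL.
exists (r.+1 * reduction_exponent r (size xs)).+1 => gamma y cg Iy.
apply: (contract_saturated (s := s ^+ reduction_exponent r (size xs))).
- exact: spec_expN.
- exact: ideal_mul.
by rewrite mulrA; apply: reduction_colon_power => // x [].
Qed.

(** Some [gamma] in [c] is invertible at [p], and its powers carry [I] into every reduction, so both
    sides equal [I_p]. *)
Lemma core_loc_outside : ~ c `<=` p -> core (ideal_loc p I) = ideal_loc p (core I).
Proof.
move=> /existsNP[gamma /not_implyP[cg pg]]; apply: ideal_eqP => x.
  move=> /core_sub/ideal_locP[a [s [ps Ia xa]]].
  have [N HN] := uniform_colon_power.
  apply/ideal_locP; exists (gamma ^+ N * a), (gamma ^+ N * s); split.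
  - by apply: spec_mulN => //; exact: spec_expN.
  - by move=> J redJ; exact: HN.
  by rewrite !rmorphM mulrCA xa.
move=> /(ideal_loc_mono (@core_sub _ I))/ideal_locP[a [s [ps Ia xa]]] L redL.
have [N HN] := contract_colon_power redL.
have [_ La] := contract_saturated (@spec_expN _ _ _ N pg) Ia (HN _ _ cg Ia).
apply: (contracts_cancel (loc_map_is_localization p) ps).
by rewrite xa.
Qed.

Lemma colon_power_primary E : c `<=` p -> saturated p E ->
  (exists N, forall gamma, c gamma -> E (gamma ^+ N)) ->
  forall b, p b -> exists n, E (b ^+ n).
Proof.
move=> cp Ep [N EN] b pb; apply: (power_mem_saturated R_noeth Ep) => q Eq qp.
suff cq : c `<=` q by rewrite -(colon_maximal cq qp).
by move=> gamma /EN/Eq/spec_exp.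
Qed.

(** A prime at which the equation fails contains [s]. It also contains [p], as powers of elements of
    [p] carry [I] into the contraction; by maximality it is [p], which excludes [s]. *)
Lemma contract_reduction L : c `<=` p -> reduction L (ideal_loc p I) ->
  reduction (contract L) I.
Proof.
move=> cp redL; have [r [s [ps HJ]]] := reduction_contract redL.
have [N HN] := contract_colon_power redL.
pose E := colon (contract L) I.
have Ep : saturated p E.
  move=> e [u [pu Eue]] y Iy; apply: (contract_saturated pu); first exact: ideal_mul.
  by rewrite mulrA; exact: Eue.
have powE := colon_power_primary cp Ep (ex_intro _ N (fun g cg y => HN g y cg)).
apply: (reduction_intro (r := r)) => [y []//|x Ix]; apply: contrapT => Lx.
have [q Lq Hq] := associated_exists R_noeth Lx.
have qs : q s by apply: Hq; exact: HJ.
have pq : p `<=` q.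
  move=> b /powE[n Ebn]; apply: (spec_exp (n := n)); apply: Hq; rewrite mulrC.
  move: x Ix {Lx}; apply: ideal_prod_transporter => u v Iu Iv.
  by rewrite mulrAC; apply: ideal_prod_mem => //; rewrite mulrC; exact: Ebn.
by apply: ps; rewrite -(colon_maximal cp pq).
Qed.

Lemma core_loc_inside : c `<=` p -> core (ideal_loc p I) = ideal_loc p (core I).
Proof.
move=> cp; apply: ideal_eqP => x; last first.
  have : ideal_loc p (core I) `<=` core (ideal_loc p I); last by apply.
  apply: ideal_gen_min => _ [a Ha <-] L redL.
  by have [] := Ha _ (contract_reduction cp redL).
move=> xcore; have /ideal_locP[a [s [ps Ia xa]]] := core_sub xcore.
have [N HN] := uniform_colon_power.
pose D := ideal_gen [set gamma ^+ N | gamma in c].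
have powD b : p b -> exists n, sat p D (b ^+ n).
  apply: (colon_power_primary cp); first exact: sat_saturated.
  by exists N => gamma cg; apply: sat_sub; apply: ideal_gen_mem; exists gamma.
have [bs bsE] := noetherian_gen R_noeth p.
have /choice[n Hn] : forall b, exists n, b \in bs -> sat p D (b ^+ n).
  move=> b; have [bbs|nbs] := boolP (b \in bs); last by exists 0%N.
  by have [|n Hn] := powD b; [rewrite bsE; exact: adjoins_mem|exists n].
(* [D] is defined from the uniform exponent, so [t] is fixed before any reduction [J] and serves all
   of them. *)
have [_ /mapP[b bbs ->]|t pt Ht] := @sat_finite _ p D [seq b ^+ n b | b <- bs].
  exact: Hn.
apply/ideal_locP; exists (t * a), (t * s); split; first exact: spec_mulN.
- move=> J redJ; apply: contrapT => Jta.
  have DJ : D `<=` transporter J a.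
    by apply: ideal_gen_min => _ [gamma cg <-]; exact: HN.
  have [q Jq Hq] := associated_exists R_noeth (C := transporter J a) (w := t) Jta.
  (* [t] carries powers of the generators of [p] into [D], so [t a] can fail to lie in [J] only at
     [p]; there [xcore] places [a] in the localized [J]. *)
  have pq : p `<=` q.
    rewrite bsE; apply: adjoins_min => [_ ->|b bbs]; first exact: ideal_zero.
    apply: (spec_exp (n := n b)); apply: Hq; apply: DJ; rewrite mulrC.
    exact/Ht/map_f.
  have qp := colon_maximal cp pq.
  have : ideal_loc p J (loc_map p a).
    by rewrite -xa; apply: ideal_mulr; apply: xcore; exact: reduction_loc.
  move=> /ideal_loc_map[u [pu Ju]]; apply: pu; rewrite -qp; apply: Hq.
  by rewrite mulrC; apply: ideal_mul.
- by rewrite !rmorphM mulrCA xa.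
Qed.

End AtPrime.

Theorem core_loc p : core (ideal_loc p I) = ideal_loc p (core I).
Proof.
by have [/core_loc_inside|/core_loc_outside] := pselect (c `<=` p).
Qed.

End CoreLocalization.

(** * Translation of the hypotheses *)

Theorem corollary3p10 (k : fieldType) (R : comAlgType k) (d : nat)
    (I : ideal R)
    (k_infinite : infinite_set [set: k])
    (R_fg : finitely_generated_algebra R)
    (R_CM : cohen_macaulay R)
    (R_dim : krull_dim R = enat d)
    (I_height : (0 < height I)%E)
    (I_Gd : G_cond d%:Z I)
    (I_S2 : weakly_residually_S2 (d%:Z - 2) I)
    (p : Spec R) :
  core (ideal_loc p I) = ideal_loc p (core I) :> set (localization p).
Proof.
have R_noeth := R_CM.1; have R_avoid := avoidance_infinite (R := R) k_infinite.
have R_CMat (q : Spec R) : cohen_macaulay_at q by exact: (cohen_macaulay_atP q R_avoid R_CM R_dim).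
have I_ht (q : Spec R) : I `<=` q -> height_geq 1 q.
  by move=> Iq; apply: (enat_lt_height R_dim 0 I).1.
have I_gen (q : Spec R) n : I `<=` q -> (n < d)%N -> ~ height_geq n.+1 q ->
    generated_at I q (zero_ideal R) n.
  move=> Iq nd hq; have [g hqE gmax] := height_primeE R_dim q.
  have gn : (g <= n)%N by rewrite leqNgt; apply/negP => /gmax.
  have := I_Gd q Iq; rewrite hqE => /(_ _)-Hmu.
  have : (mu (ideal_loc q I) <= enat g)%E.
    apply: Hmu; rewrite /enat lee_fin lerBrDr -[1]/(Posz 1) -PoszD lez_nat addn1.
    exact: leq_ltn_trans nd.
  rewrite /mu; set A := [set _ | _ in _] => muA.
  (* An empty [A] would give [mu] its default value [+oo]. *)
  have [A0|/set0P A0] := eqVneq A set0.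
    by move: muA; rewrite A0 /infimum eqxx.
  have [|[n' gen_n' n'E] _] := enat_inf _ A0; first by move=> y [m _ <-]; exists m.
  move: muA; rewrite -n'E lee_enat => n'g.
  by apply: generated_at_mono (generated_by_loc gen_n') => //; exact: leq_trans gn.
have S2 (ys : seq R) : (size ys + 2 <= d)%N -> (forall z, z \in ys -> I z) ->
    let C := adjoins (zero_ideal R) ys in let K := colon C I in
    ~ I `<=` C -> (forall q : Spec R, K `<=` q -> height_geq (size ys) q) ->
    (forall q : Spec R, I `<=` q -> K `<=` q -> height_geq (size ys).+1 q) ->
    forall q q0 q1 : Spec R, K `<=` q0 -> q0 `<` q1 -> q1 `<` q ->
    exists u v, regular_at q K [:: u; v].
  move=> sz ysI C K IC Kht IKht q q0 q1; apply: serre_S2_regular_at.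
  apply: (I_S2 (size ys)).
    by rewrite lerBrDr -[2]/(Posz 2) -PoszD lez_nat.
  split; last first.
    apply/(enat_lt_height R_dim) => r IKr; apply: IKht => y Hy; apply: IKr.
      exact: ideal_sum_subl.
    exact: ideal_sum_subr.
  exists C; split=> //; last by apply/(enat_le_height R_dim).
    by split=> //; apply: adjoins_min => // _ ->; exact: ideal_zero.
  by exists (in_tuple ys); rewrite /C -ideal_gen_seq.
have [ys [sz ysI ys_dseq ys_ht]] :=
  general_elements R_noeth R_avoid R_CMat I_ht I_gen S2.
by rewrite (core_loc R_noeth (@height_leq_dim _ _ R_dim) ysI ys_dseq ys_ht).
Qed.
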